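(* (Decomposition of quadratic forms.) Let $f=x^2A+2xyB+y^2C$ be a quadratic form with $A,B,C\in H_{I\setminus\{0,1\}}$, and let $d_2=2AC-2B^2-2hAB+\frac{3h^2}2A^2$ be its discriminant. Then $$f\,P_{01}^2f=(P_{01}f)^2+\tfrac12d_2\,(01)^2,$$ and in the central skew field extension $Q_I\bigl[\sqrt{-\frac12d_2}\bigr]$ one has the decomposition into two linear forms $$f\,P_{01}^2f=\Bigl(P_{01}f+(01)\sqrt{-\tfrac12d_2}\Bigr)\Bigl(P_{01}f-(01)\sqrt{-\tfrac12d_2}\Bigr)=(xY_1-yX_1-hyY_1)(xY_2-yX_2-hyY_2)$$ with $$X_{1,2}=-x_1B-y_1C\pm x_1\sqrt{-\tfrac12d_2}-2hy_1B-\tfrac32hx_1A,\qquad Y_{1,2}=x_1A+y_1B\pm y_1\sqrt{-\tfrac12d_2}-\tfrac12hy_1A .$$ The corresponding projective coordinates are $$Z_{1,2}=X_{1,2}Y_{1,2}^{-1}+\tfrac h2=\Bigl(-B\pm\sqrt{-\tfrac12d_2}\Bigr)A^{-1}.$$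
   Context: Fix $h\in\mathbb C$, $h\neq0$. $U_h(sl(2))$ is the complex unital Hopf algebra with generators $E,F,H$, relations $[H,E]=E\cosh(hF)+\cosh(hF)E$, $[H,F]=-\frac2h\sinh(hF)$, $[E,F]=H$, and coproduct $\Delta(E)=E\otimes e^{-hF}+e^{hF}\otimes E$, $\Delta(F)=F\otimes1+1\otimes F$, $\Delta(H)=H\otimes e^{-hF}+e^{hF}\otimes H$. For a totally ordered index set $I$, $H_I$ is the unital complex algebra with generators $x_i,y_i$ ($i\in I$) and relations $x_iy_i=y_ix_i+hy_i^2$ and, for $i<j$, $x_jy_i=y_ix_j+hy_iy_j$, $y_jx_i=x_iy_j-hy_iy_j$, $y_jy_i=y_iy_j$, $x_jx_i=x_ix_j-hx_iy_j+hy_ix_j+h^2y_iy_j$. It is a $U_h(sl(2))$-module algebra via $Hx_i=x_i$, $Hy_i=-y_i$, $Ex_i=0$, $Ey_i=x_i$, $Fx_i=y_i$, $Fy_i=0$, $E1=F1=H1=0$ and the Leibniz rules given by the coproduct. $H_I$ is a domain with right quotient division ring $Q_I$. $H_I^{Inv}$ is the set of $v\in H_I$ with $Ev=Fv=Hv=0$. $(ij)=x_iy_j-y_ix_j-hy_iy_j$. Assume $0,1\in I$, $x=x_0$, $y=y_0$. $H_J\subseteq H_I$ is the subalgebra generated by $x_i,y_i$, $i\in J$. An $n$-form is a nonzero element $f=\sum_i\binom nix^{n-i}y^iA_i\in H_I^{Inv}$ with $A_i\in H_{I\setminus\{0\}}$; quadratic form $=2$-form, linear form $=1$-form. $\Delta_{01}$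 is the derivation of $H_I$ with $x_0\mapsto x_1$, $y_0\mapsto y_1$ and all other generators $\mapsto0$; $P_{01}a=\frac1m\Delta_{01}(a)$ if $a$ is homogeneous of degree $m$ in the index $0$. In the extension $Q_I[\sqrt{-\frac12d_2}]$ the adjoined element is central and squares to $-\frac12d_2$. The upper sign belongs to the index $1$ and the lower sign to the index $2$. *)

(* Defs.v *)
From HB Require Import structures.
From mathcomp Require Import all_boot all_order all_algebra.
From mathcomp Require Export complex.
From mathcomp Require Import boolp classical_sets functions cardinality fsbigop.
From mathcomp Require Export reals.
Set Implicit Arguments.
Unset Strict Implicit.
Unset Printing Implicit Defensive.
Import Order.TTheory GRing.Theory Num.Theory.
Local Open Scope classical_set_scope.
Local Open Scope ring_scope.

(* The complex numbers are R[i] for R : realType. *)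

(* For locally nilpotent T the exponential series has finite support at every *)
(* vector, so that the finitely supported big sum computes e^(t T) v.         *)
Definition expop (R : realType) (V : lmodType R[i]) (T : V -> V) (t : R[i])
    (v : V) : V :=
  \sum_(k \in [set: nat]) ((t ^+ k / (k`!)%:R) *: iter k T v).

Definition coshop (R : realType) (V : lmodType R[i]) (T : V -> V) (t : R[i])
    (v : V) : V :=
  2^-1 *: (expop T t v + expop T (- t) v).

Definition sinhop (R : realType) (V : lmodType R[i]) (T : V -> V) (t : R[i])
    (v : V) : V :=
  2^-1 *: (expop T t v - expop T (- t) v).

(* A U_h(sl(2))-module on which F is locally nilpotent, given by the action   *)
(* of the generators. Local nilpotency of F gives a meaning to exp(+-hF),     *)
(* cosh(hF) and sinh(hF).                                                     *)
Record Uh_module (R : realType) (h : R[i]) (V : lmodType R[i])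
    (E F H : {linear V -> V}) : Prop := {
  Uh_F_nilp : forall v, exists n, iter n F v = 0;
  Uh_HE : forall v, H (E v) - E (H v) = E (coshop F h v) + coshop F h (E v);
  Uh_HF : forall v, H (F v) - F (H v) = - (2 / h) *: sinhop F h v;
  Uh_EF : forall v, E (F v) - F (E v) = H v }.

(* The Leibniz rules are the coproducts                                       *)
(*   Delta(E) = E (x) e^(-hF) + e^(hF) (x) E, Delta(F) = F (x) 1 + 1 (x) F,   *)
(*   Delta(H) = H (x) e^(-hF) + e^(hF) (x) H.                                 *)
Record Uh_module_algebra (R : realType) (h : R[i]) (A : algType R[i])
    (E F H : {linear A -> A}) : Prop := {
  Uh_mod : Uh_module h E F H;
  Uh_unit : [/\ E 1 = 0, F 1 = 0 & H 1 = 0];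
  Uh_ME : forall a b,
    E (a * b) = E a * expop F (- h) b + expop F h a * E b;
  Uh_MF : forall a b, F (a * b) = F a * b + a * F b;
  Uh_MH : forall a b,
    H (a * b) = H a * expop F (- h) b + expop F h a * H b }.

Definition invariants (R : realType) (A : algType R[i])
    (E F H : {linear A -> A}) : set A :=
  [set v | [/\ E v = 0, F v = 0 & H v = 0]].

Record HI_relations (R : realType) (h : R[i]) (d : Order.disp_t)
    (I : orderType d) (A : algType R[i]) (x y : I -> A) : Prop := {
  HI_xy : forall i, x i * y i = y i * x i + h *: y i ^+ 2;
  HI_xjyi : forall i j, (i < j)%O ->
    x j * y i = y i * x j + h *: (y i * y j);
  HI_yjxi : forall i j, (i < j)%O ->
    y j * x i = x i * y j - h *: (y i * y j);
  HI_yjyi : forall i j, (i < j)%O -> y j * y i = y i * y j;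
  HI_xjxi : forall i j, (i < j)%O ->
    x j * x i = x i * x j - h *: (x i * y j) + h *: (y i * x j)
                + h ^+ 2 *: (y i * y j) }.

(* HI is the algebra presented by the generators x_i, y_i and the relations   *)
(* above: it satisfies them, and every family satisfying them in an algebra A *)
(* is the image of the generators under exactly one algebra morphism HI -> A. *)
Definition presents_HI (R : realType) (h : R[i]) (d : Order.disp_t)
    (I : orderType d) (HI : algType R[i]) (x y : I -> HI) : Prop :=
  HI_relations h x y /\
  forall (A : algType R[i]) (x' y' : I -> A), HI_relations h x' y' ->
    exists phi : {lrmorphism HI -> A},
      (forall i, phi (x i) = x' i /\ phi (y i) = y' i) /\
      (forall psi : {lrmorphism HI -> A},
        (forall i, psi (x i) = x' i /\ psi (y i) = y' i) -> psi =1 phi).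

Definition HI_action (R : realType) (h : R[i]) (d : Order.disp_t)
    (I : orderType d) (HI : algType R[i]) (x y : I -> HI)
    (E F H : {linear HI -> HI}) : Prop :=
  Uh_module_algebra h E F H /\
  forall i, [/\ H (x i) = x i /\ H (y i) = - y i,
                E (x i) = 0 /\ E (y i) = x i
              & F (x i) = y i /\ F (y i) = 0].

(* H_J, the smallest subalgebra containing x_i and y_i for i in J. *)
Definition HJ (R : realType) (d : Order.disp_t) (I : orderType d)
    (HI : algType R[i]) (x y : I -> HI) (J : {pred I}) : set HI :=
  [set a | forall S : {pred HI}, GRing.subalg_closed S ->
     (forall i, i \in J -> x i \in S /\ y i \in S) -> a \in S].

Definition bracket (R : realType) (h : R[i]) (d : Order.disp_t)
    (I : orderType d) (HI : algType R[i]) (x y : I -> HI) (i j : I) : HI :=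
  x i * y j - y i * x j - h *: (y i * y j).

(* n-forms in the variables x, y: nonzero elements of inv of the shape        *)
(* \sum_i 'C(n, i) x^(n-i) y^i a_i with coefficients a_i in coef.             *)
Definition is_form (K : nzRingType) (x y : K) (coef inv : set K) (n : nat)
    (f : K) : Prop :=
  [/\ f != 0, inv f
    & exists2 a : 'I_n.+1 -> K, (forall i, coef (a i))
      & f = \sum_(i < n.+1) ('C(n, i))%:R * (x ^+ (n - i) * y ^+ i * a i)].

(* homogeneous x y j m a: a is homogeneous of degree m in the index j. *)
Inductive homogeneous (R : realType) (d : Order.disp_t) (I : orderType d)
    (HI : algType R[i]) (x y : I -> HI) (j : I) : nat -> HI -> Prop :=
| homog_scalar c : homogeneous x y j 0 c%:A
| homog_x i : homogeneous x y j (i == j) (x i)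
| homog_y i : homogeneous x y j (i == j) (y i)
| homog_add m a b : homogeneous x y j m a -> homogeneous x y j m b ->
    homogeneous x y j m (a + b)
| homog_mul m n a b : homogeneous x y j m a -> homogeneous x y j n b ->
    homogeneous x y j (m + n) (a * b).

(* Delta = Delta_{i0 i1}. *)
Definition is_polar_derivation (R : realType) (d : Order.disp_t)
    (I : orderType d) (HI : algType R[i]) (x y : I -> HI) (i0 i1 : I)
    (Delta : {linear HI -> HI}) : Prop :=
  [/\ forall a b, Delta (a * b) = Delta a * b + a * Delta b,
      Delta (x i0) = x i1 /\ Delta (y i0) = y i1
    & forall i, i != i0 -> Delta (x i) = 0 /\ Delta (y i) = 0].

(* P = P_{i0 i1}; its values on elements that are not homogeneous of positive *)
(* degree in the index i0 are left unspecified.                               *)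
Definition is_polarization (R : realType) (d : Order.disp_t)
    (I : orderType d) (HI : algType R[i]) (x y : I -> HI) (i0 : I)
    (Delta : HI -> HI) (P : HI -> HI) : Prop :=
  forall m a, (0 < m)%N -> homogeneous x y i0 m a ->
    P a = (m%:R)^-1 *: Delta a.

(* Q is a division ring containing HI through iota, in which every element is *)
(* a right quotient a b^-1 with a, b in HI.                                   *)
Definition is_right_quotient_ring (R : realType) (HI : algType R[i])
    (Q : unitAlgType R[i]) (iota : {lrmorphism HI -> Q}) : Prop :=
  [/\ forall q : Q, q != 0 -> q \is a GRing.unit,
      injective iota
    & forall q : Q, exists a b, b != 0 /\ q = iota a / iota b].

(* K = Q[s] with s central and s^2 = c. If c is not a square in Q, this is    *)
(* Q[t]/(t^2 - c); otherwise K may also be Q itself, with s a square root of  *)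
(* c in Q. K is not required to be a division ring: both are covered.         *)
Definition is_sqrt_extension (R : realType) (Q K : unitAlgType R[i])
    (j : {lrmorphism Q -> K}) (c : Q) (s : K) : Prop :=
  [/\ forall k, s * k = k * s,
      s ^+ 2 = j c
    & forall k, exists a b, k = j a + j b * s].

(* For S a subset of HI, mapped to K by phi: the set S[s] = S + S s. Applied  *)
(* to H_J it gives the coefficients, applied to the invariants of HI it gives *)
(* the invariants of HI[s], s being an invariant.                             *)
Definition adjoin (HI K : nzRingType) (phi : HI -> K) (s : K) (S : set HI) :
    set K :=
  [set k | exists a b, [/\ S a, S b & k = phi a + phi b * s]].

(* Main.v *)
Require Import Defs.
From HB Require Import structures.
From mathcomp Require Import all_boot all_order all_algebra.
From mathcomp Require Import boolp classical_sets fsbigop.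
From mathcomp Require Import ring.
Set Implicit Arguments.
Unset Strict Implicit.
Unset Printing Implicit Defensive.
Import Order.TTheory GRing.Theory Num.Theory.
Local Open Scope ring_scope.

(* Write x, y, X, Y for x_0, y_0, x_1, y_1, and p = P_01 f, g = P_01^2 f,     *)
(* z = (01). For all a in H_I,                                                *)
(*   y_j a = e^(-hF)(a) y_j,                                                  *)
(*   x_j a = e^(hF)(a) x_j + h (sinh(hF)(a) - H(a)) y_j,                      *)
(* so that every element killed by F and H is central. As Delta_01 commutes   *)
(* with E, F and H, the elements f, p, g, z are central. Elimination gives    *)
(*   z^2 A            = f Y^2 - 2 p y Y + g y^2,                              *)
(*   z^2 (B + h/2 A)  = p (Xy + xY) - f XY - g xy,                            *)
(* and a similar formula for C. The commutation rules of A, B, C with the     *)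
(* generators and with each other, and f g = p^2 + d_2 z^2 / 2, follow by     *)
(* cancelling z^2. With these rules each of the two pairs of linear forms     *)
(* agrees termwise, and A (X_i + h/2 Y_i) = (- B +- s - 2 h A) Y_i. The       *)
(* latter exhibits a left inverse of Y_i, because the forms are units.        *)

(** * Normalization of noncommutative polynomials *)

(** Centrality of the invariants turns the theorem into linear algebra. [y_commute] and [x_commute]
    express multiplication by generators through the action, so elements killed by [F] and [H] are
    central ([invariant_central]); [Delta_F], [Delta_E], [Delta_H] make p and g invariant along with
    f. Now f, p, g give three linear equations in A, B, C, and solving them ([coefA], [coefB],
    [coefC]) yields z^2 A, and similarly for B and C, as polynomials in the generators with central
    coefficients. As H_I is a domain and z is central and nonzero ([bracket_neq0]), z^2 cancels: the
    commutation rules of A, B, C follow from those of the generators, and [discriminantE] from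
    substituting the solutions back.

    Since s is central with 2 s^2 = - d_2, f g = (p + z s)(p - z s) is a difference of squares, and
    [linear_formE] identifies each factor with its linear form. The coordinates Z_i come from
    [projective_coordinateE]. Dividing by Y_i takes an argument, as K is not assumed to be a
    division ring: f and g are nonzero ([polar2_neq0]), so both forms are units of K; each is a left
    multiple of Y_i, and a norm to Q ([unitr_of_left_inverses]) turns left inverses for both signs
    into inverses. Finally A is nonzero by [lead_coef_neq0]. *)

Inductive nce :=
| NVar of nat | NNat of nat | NAdd of nce & nce | NOpp of nce
| NMul of nce & nce | NExp of nce & nat.

Definition ncterm : Type := int * seq nat.

Definition ncmul (p q : seq ncterm) : seq ncterm :=
  flatten [seq [seq (t.1 * u.1, t.2 ++ u.2) | u <- q] | t <- p].

Fixpoint ncflat (e : nce) : seq ncterm :=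
  match e with
  | NVar i => [:: (1, [:: i])]
  | NNat n => [:: (n%:Z, [::])]
  | NAdd a b => ncflat a ++ ncflat b
  | NOpp a => [seq (- t.1, t.2) | t <- ncflat a]
  | NMul a b => ncmul (ncflat a) (ncflat b)
  | NExp a n => iter n (ncmul (ncflat a)) [:: (1, [::])]
  end.

(** The rule ((i, j), e) replaces the product of the atoms i and j, in this order, by e. *)
Definition ncrule : Type := nat * nat * nce.

Fixpoint nclookup (rs : seq ncrule) (i j : nat) : option nce :=
  if rs is r :: rs' then
    if (r.1.1 == i) && (r.1.2 == j) then Some r.2 else nclookup rs' i j
  else None.

(** [pre] holds the letters already passed, in reverse; one call replaces the leftmost matching
    pair. *)
Fixpoint ncrewrite (rs : seq ncrule) (pre w : seq nat) :
    option (seq ncterm) :=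
  if w is i :: w1 then
    if w1 is j :: w2 then
      if nclookup rs i j is Some e
      then Some (ncmul [:: (1, rev pre)] (ncmul (ncflat e) [:: (1, w2)]))
      else ncrewrite rs (i :: pre) w1
    else None
  else None.

Fixpoint ncinsert (t : ncterm) (p : seq ncterm) : seq ncterm :=
  if p is u :: p' then
    if t.2 == u.2 then (t.1 + u.1, t.2) :: p' else u :: ncinsert t p'
  else [:: t].

(** [n] is fuel. When it runs out, the pending terms are returned as they are, so the value is
    preserved for every [n]. *)
Fixpoint ncnorm (rs : seq ncrule) (n : nat) (todo acc : seq ncterm) :
    seq ncterm :=
  if n is n'.+1 then
    if todo is t :: p then
      if ncrewrite rs [::] t.2 is Some q
      then ncnorm rs n' (ncmul [:: (t.1, [::])] q ++ p) acc
      else ncnorm rs n' p (ncinsert t acc)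
    else acc
  else todo ++ acc.

Section NcRing.
Variables (D : pzRingType) (v : seq D).

Fixpoint nceval (e : nce) : D :=
  match e with
  | NVar i => v`_i
  | NNat n => n%:R
  | NAdd a b => nceval a + nceval b
  | NOpp a => - nceval a
  | NMul a b => nceval a * nceval b
  | NExp a n => nceval a ^+ n
  end.

Definition nctev (t : ncterm) : D := t.1%:~R * \prod_(i <- t.2) v`_i.
Definition ncpev (p : seq ncterm) : D := \sum_(t <- p) nctev t.

Fixpoint ncvalid (rs : seq ncrule) : Prop :=
  if rs is r :: rs' then v`_r.1.1 * v`_r.1.2 = nceval r.2 /\ ncvalid rs'
  else True.

Lemma ncpev_cat p q : ncpev (p ++ q) = ncpev p + ncpev q.
Proof. by rewrite /ncpev big_cat. Qed.

Lemma ncpev_cons t p : ncpev (t :: p) = nctev t + ncpev p.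
Proof. by rewrite /ncpev big_cons. Qed.

Lemma ncpev_nil : ncpev [::] = 0.
Proof. by rewrite /ncpev big_nil. Qed.

Lemma ncpev_mul p q : ncpev (ncmul p q) = ncpev p * ncpev q.
Proof.
rewrite {1}/ncpev /ncmul big_flatten big_map mulr_suml.
apply: eq_bigr => t _; rewrite big_map mulr_sumr; apply: eq_bigr => u _.
rewrite /nctev big_cat /= intrM -!mulrA; congr (_ * _).
by rewrite !mulrA; congr (_ * _); rewrite commr_int.
Qed.

Lemma ncpev_flat e : ncpev (ncflat e) = nceval e.
Proof.
elim: e => [i|n|a iha b ihb|a iha|a iha b ihb|a iha n] /=.
- by rewrite /ncpev big_seq1 /nctev big_seq1 mul1r.
- by rewrite /ncpev big_seq1 /nctev big_nil mulr1.
- by rewrite ncpev_cat iha ihb.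
- rewrite -iha /ncpev big_map -sumrN; apply: eq_bigr => t _.
  by rewrite /nctev intrN mulNr.
- by rewrite ncpev_mul iha ihb.
- elim: n => [|n ihn] /=; last by rewrite ncpev_mul iha ihn exprS.
  by rewrite /ncpev big_seq1 /nctev big_nil mulr1.
Qed.

Lemma ncpev_insert t p : ncpev (ncinsert t p) = nctev t + ncpev p.
Proof.
elim: p => [|u p ih] /=; first by rewrite ncpev_cons.
case: (t.2 =P u.2) => tu; rewrite !ncpev_cons ?ih.
  by rewrite addrA; congr (_ + _); rewrite /nctev tu intrD mulrDl.
by rewrite addrCA.
Qed.

Lemma nclookupP rs i j e :
  ncvalid rs -> nclookup rs i j = Some e -> v`_i * v`_j = nceval e.
Proof.
elim: rs => [|r rs ih] //= [r_ok rs_ok].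
by case: ifP => [/andP[/eqP<- /eqP<-] [<-]|_ /ih]; last exact.
Qed.

Lemma ncpev_word w : ncpev [:: (1, w)] = \prod_(i <- w) v`_i.
Proof. by rewrite /ncpev big_seq1 /nctev mul1r. Qed.

Lemma ncrewriteP rs pre w q :
  ncvalid rs -> ncrewrite rs pre w = Some q ->
  ncpev q = (\prod_(i <- rev pre) v`_i) * \prod_(i <- w) v`_i.
Proof.
move=> rs_ok; elim: w pre => [|i [|j w] ih] pre //.
rewrite [ncrewrite _ _ _]/=; case e_ij: (nclookup rs i j) => [e|].
  case=> <-; rewrite !ncpev_mul !ncpev_word ncpev_flat.
  by rewrite -(nclookupP rs_ok e_ij) !big_cons !mulrA.
by move=> /ih ->; rewrite rev_cons -cats1 big_cat /= big_seq1 !big_cons !mulrA.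
Qed.

Lemma ncpev_norm rs n todo acc :
  ncvalid rs -> ncpev (ncnorm rs n todo acc) = ncpev todo + ncpev acc.
Proof.
move=> rs_ok; elim: n todo acc => [|n ih] [|t p] acc /=;
  rewrite -?cat_cons ?ncpev_cat ?ncpev_nil ?add0r //.
case e_q: (ncrewrite rs [::] t.2) => [q|]; last first.
  by rewrite ih ncpev_insert ncpev_cons addrA [nctev t + _]addrC.
rewrite ih ncpev_cat ncpev_mul (ncrewriteP rs_ok e_q) /= big_nil mul1r.
by rewrite ncpev_cons /ncpev big_seq1 /nctev big_nil mulr1.
Qed.

Lemma nc_eq rs n a b :
  ncvalid rs ->
  all (fun t => t.1 == 0) (ncnorm rs n (ncflat (NAdd a (NOpp b))) [::]) ->
  nceval a = nceval b.
Proof.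
move=> rs_ok ab0; apply/eqP; rewrite -subr_eq0; apply/eqP.
rewrite -[LHS](ncpev_flat (NAdd a (NOpp b))) -[LHS]addr0 -ncpev_nil.
rewrite -(ncpev_norm n _ _ rs_ok); elim: (ncnorm _ _ _ _) ab0 => [|t p ih] /=.
  by rewrite ncpev_nil.
by case/andP=> /eqP t0 /ih; rewrite ncpev_cons /nctev t0 mul0r add0r.
Qed.

End NcRing.

Ltac nc_index x env :=
  lazymatch env with
  | x :: _ => constr:(0%N)
  | _ :: ?env' => let n := nc_index x env' in constr:(S n)
  end.

Ltac nc_reify env t :=
  lazymatch t with
  | (?a + ?b)%R =>
    let a' := nc_reify env a in let b' := nc_reify env b in
    constr:(NAdd a' b')
  | (- ?a)%R => let a' := nc_reify env a in constr:(NOpp a')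
  | (?a * ?b)%R =>
    let a' := nc_reify env a in let b' := nc_reify env b in
    constr:(NMul a' b')
  | (?a ^+ ?n)%R => let a' := nc_reify env a in constr:(NExp a' n)
  | (1 *+ ?n)%R => constr:(NNat n)
  | 1%R => constr:(NNat 1)
  | 0%R => constr:(NNat 0)
  | _ => let n := nc_index t env in constr:(NVar n)
  end.

Ltac nc_rule env H :=
  lazymatch type of H with
  | (?a * ?b)%R = ?c =>
    let i := nc_index a env in let j := nc_index b env in
    let e := nc_reify env c in constr:(((i, j), e))
  end.

Ltac nc_rules env Hs :=
  lazymatch Hs with
  | (?Hs', ?H) =>
    let rs := nc_rules env Hs' in let r := nc_rule env H in
    constr:(r :: rs)
  | ?H => let r := nc_rule env H in constr:([:: r])
  end.

Ltac nc_valid Hs :=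
  lazymatch Hs with
  | (?Hs', ?H) => let p := nc_valid Hs' in constr:(conj H p)
  | ?H => constr:(conj H I)
  end.

(* ncring env (H1, ..., Hn) proves an equality of ring expressions over the   *)
(* atoms env by rewriting with the Hi, which must be of the form a * b = e    *)
(* for atoms a and b, and comparing the resulting noncommutative polynomials. *)
Ltac ncring env Hs :=
  let rs := nc_rules env Hs in
  lazymatch goal with
  | |- ?l = ?r =>
    let a := nc_reify env l in let b := nc_reify env r in
    let p := nc_valid Hs in
    change (nceval env a = nceval env b);
    apply: (@nc_eq _ env rs 5000 a b); [exact: p | by vm_compute]
  end.

(** * Quadratic forms in a domain *)

Section QuadraticForm.
Variables (D : nzRingType) (k x y X Y A B C f p g : D).
Let z := x * Y - y * X - 2%:R * k * y * Y.
Hypothesis domD : forall a b : D, a * b = 0 -> a = 0 \/ b = 0.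
Hypothesis two_neq0 : 2%:R != 0 :> D.
Hypothesis z_neq0 : z != 0.
Hypothesis ck : forall a, a * k = k * a.
Hypothesis cf : forall a, a * f = f * a.
Hypothesis cp : forall a, a * p = p * a.
Hypothesis cg : forall a, a * g = g * a.
Hypothesis cz : forall a, a * z = z * a.
Hypothesis xy : x * y = y * x + 2%:R * k * y * y.
Hypothesis xY : x * Y = Y * x + 2%:R * k * y * Y.
Hypothesis Xy : X * y = y * X + 2%:R * k * y * Y.
Hypothesis XY : X * Y = Y * X + 2%:R * k * Y * Y.
Hypothesis Yy : Y * y = y * Y.
Hypothesis Xx : X * x = x * X - 2%:R * k * Y * x + 2%:R * k * y * X.
Hypothesis ef : f = x ^+ 2 * A + 2%:R * (x * y * B) + y ^+ 2 * C.
Hypothesis ep : 2%:R * p =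
  (X * x + x * X) * A + 2%:R * (X * y + x * Y) * B + 2%:R * y * Y * C.
Hypothesis eg : g = X ^+ 2 * A + 2%:R * (X * Y * B) + Y ^+ 2 * C.

Lemma domD_cancel (c a b : D) : c != 0 -> c * a = c * b -> a = b.
Proof.
move=> c_neq0 /eqP; rewrite -subr_eq0 -mulrBr => /eqP/domD[|/eqP].
  by move=> c0; rewrite c0 eqxx in c_neq0.
by rewrite subr_eq0 => /eqP.
Qed.

Lemma cancel_z2 (a b : D) : z ^+ 2 * a = z ^+ 2 * b -> a = b.
Proof. by rewrite expr2 -!mulrA => /(domD_cancel z_neq0)/(domD_cancel z_neq0). Qed.

(** Elimination of B and C from the equations for f, p and g, as in Cramer's rule. *)
Lemma coefA : z ^+ 2 * A = f * Y ^+ 2 - 2%:R * p * (y * Y) + g * y ^+ 2.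
Proof.
(* The central f, p, g go to the right, so that after substitution A, B, C end every word and only
   the rules of the generators are needed. *)
have -> : f * Y ^+ 2 - 2%:R * p * (y * Y) + g * y ^+ 2 =
  Y ^+ 2 * f - y * Y * (2%:R * p) + y ^+ 2 * g.
  ncring [:: y; Y; f; p; g] (cf y, cf Y, cp y, cp Y, cg y, cg Y).
rewrite ep [in RHS]ef [in RHS]eg /z.
ncring [:: k; y; Y; x; X; A; B; C]
  (xy, xY, Xy, XY, Yy, Xx, ck y, ck Y, ck x, ck X).
Qed.

Lemma coefB : z ^+ 2 * (B + k * A) =
  p * (X * y + x * Y) - f * (X * Y) - g * (x * y).
Proof.
(* Doubling is due to [ep], which gives 2 p. *)
apply: (domD_cancel two_neq0).
have -> : 2%:R * (p * (X * y + x * Y) - f * (X * Y) - g * (x * y)) =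
  (X * y + x * Y) * (2%:R * p) - 2%:R * (X * Y) * f - 2%:R * (x * y) * g.
  ncring [:: x; X; y; Y; f; p; g]
    (cf y, cf Y, cp y, cp Y, cg y, cg Y, cf x, cf X, cp x, cp X, cg x, cg X).
rewrite ep [in RHS]ef [in RHS]eg /z.
ncring [:: k; y; Y; x; X; A; B; C]
  (xy, xY, Xy, XY, Yy, Xx, ck y, ck Y, ck x, ck X).
Qed.

Lemma coefC : z ^+ 2 * (C + 6%:R * k * B + 6%:R * k ^+ 2 * A) =
  f * X ^+ 2 - p * (X * x + x * X) + g * x ^+ 2.
Proof.
apply: (domD_cancel two_neq0).
have -> : 2%:R * (f * X ^+ 2 - p * (X * x + x * X) + g * x ^+ 2) =
  2%:R * X ^+ 2 * f - (X * x + x * X) * (2%:R * p) + 2%:R * x ^+ 2 * g.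
  ncring [:: x; X; y; Y; f; p; g]
    (cf y, cf Y, cp y, cp Y, cg y, cg Y, cf x, cf X, cp x, cp X, cg x, cg X).
rewrite ep [in RHS]ef [in RHS]eg /z.
ncring [:: k; y; Y; x; X; A; B; C]
  (xy, xY, Xy, XY, Yy, Xx, ck y, ck Y, ck x, ck X).
Qed.

Lemma z2C (a b : D) : z ^+ 2 * (a * b) = a * (z ^+ 2 * b).
Proof.
by rewrite !mulrA; congr (_ * _); rewrite expr2 -!mulrA -cz -mulrA -cz mulrA.
Qed.

(** By [coefA], z^2 A is a polynomial in the commuting y, Y with central coefficients. The rules
    below follow the same pattern. *)
Lemma commAY : A * Y = Y * A.
Proof.
apply: cancel_z2; rewrite (z2C Y) mulrA coefA.
ncring [:: k; f; p; g; y; Y; x; X] (cf y, cf Y, cp y, cp Y, cg y, cg Y, Yy).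
Qed.

Lemma commAX : A * X = X * A - 4%:R * k * Y * A.
Proof.
apply: cancel_z2; rewrite mulrBr (z2C X) (z2C (4%:R * k * Y)) mulrA coefA.
ncring [:: k; f; p; g; y; Y; x; X]
  (cf y, cf Y, cp y, cp Y, cg y, cg Y, Yy, cf X, cp X, cg X, ck y, ck Y, ck X,
   Xy, XY, ck f, ck p, ck g).
Qed.

Lemma commAy : A * y = y * A.
Proof.
apply: cancel_z2; rewrite (z2C y) mulrA coefA.
ncring [:: k; f; p; g; y; Y; x; X] (cf y, cf Y, cp y, cp Y, cg y, cg Y, Yy).
Qed.

Lemma commAx : A * x = x * A - 4%:R * k * y * A.
Proof.
apply: cancel_z2; rewrite mulrBr (z2C x) (z2C (4%:R * k * y)) mulrA coefA.
ncring [:: k; f; p; g; y; Y; x; X]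
  (cf y, cf Y, cp y, cp Y, cg y, cg Y, Yy, cf x, cp x, cg x, ck y, ck Y, ck x,
   xy, xY, ck f, ck p, ck g).
Qed.

Lemma commBY : B * Y = Y * B - 2%:R * k * Y * A.
Proof.
(* [coefB] describes B + k A; the part k A is removed by [commAY]. *)
suff: (B + k * A) * Y = Y * (B + k * A) - 2%:R * k * Y * A.
  move=> E; apply: (addIr (k * A * Y)); rewrite -mulrDl E.
  ncring [:: k; y; Y; A; B] (ck y, ck Y, commAY).
apply: cancel_z2; rewrite mulrBr (z2C Y) (z2C (2%:R * k * Y)) mulrA coefB coefA.
ncring [:: k; f; p; g; y; Y; x; X]
  (cf y, cf Y, cp y, cp Y, cg y, cg Y, Yy, cf X, cp X, cg X, ck y, ck Y, ck X,
   Xy, XY, ck f, ck p, ck g, xy, xY, Xx, ck x, cf x, cp x, cg x).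
Qed.

Lemma commBX : B * X = X * B + 2%:R * k * X * A + 4%:R * k ^+ 2 * Y * A.
Proof.
suff: (B + k * A) * X = X * (B + k * A) + 2%:R * k * X * A.
  move=> E; apply: (addIr (k * A * X)); rewrite -mulrDl E.
  ncring [:: k; Y; X; A; B] (ck X, ck Y, commAX).
apply: cancel_z2; rewrite mulrDr (z2C X) (z2C (2%:R * k * X)) mulrA coefB coefA.
ncring [:: k; f; p; g; y; Y; x; X]
  (cf y, cf Y, cp y, cp Y, cg y, cg Y, Yy, cf X, cp X, cg X, ck y, ck Y, ck X,
   Xy, XY, ck f, ck p, ck g, xy, xY, Xx, ck x, cf x, cp x, cg x).
Qed.

Lemma commBA : B * A = A * B - 4%:R * k * A ^+ 2.
Proof.
suff: A * (B + k * A) = (B + k * A) * A + 4%:R * k * A * A.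
  move=> E; apply: (addIr (k * A * A)); rewrite -mulrDl.
  apply: (addIr (4%:R * k * A * A)); rewrite -E.
  ncring [:: k; A; B] (ck A).
apply: cancel_z2.
have -> : z ^+ 2 * ((B + k * A) * A + 4%:R * k * A * A) =
  z ^+ 2 * (B + k * A) * A + 4%:R * k * (z ^+ 2 * A) * A.
  by rewrite -z2C mulrDr !mulrA.
rewrite z2C coefB coefA.
ncring [:: k; f; p; g; y; Y; x; X; A]
  (cf y, cf Y, cp y, cp Y, cg y, cg Y, Yy, cf X, cp X, cg X, ck y, ck Y, ck X,
   Xy, XY, ck f, ck p, ck g, xy, xY, Xx, ck x, cf x, cp x, cg x,
   ck A, cf A, cp A, cg A, commAX, commAY, commAx, commAy).
Qed.

Lemma commCA : C * A = A * C - 8%:R * k * A * B + 24%:R * k ^+ 2 * A ^+ 2.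
Proof.
pose B' := B + k * A; pose C' := C + 6%:R * k * B + 6%:R * k ^+ 2 * A.
suff: A * C' = C' * A + (8%:R * k * B' + 24%:R * k ^+ 2 * A) * A.
  move=> E; apply: (addIr (A * C')); rewrite {2}E /C' /B'.
  ncring [:: k; A; B; C] (ck A, ck B, commBA).
apply: cancel_z2.
have -> : z ^+ 2 * (C' * A + (8%:R * k * B' + 24%:R * k ^+ 2 * A) * A) =
  z ^+ 2 * C' * A
    + (8%:R * k * (z ^+ 2 * B') + 24%:R * k ^+ 2 * (z ^+ 2 * A)) * A.
  rewrite mulrDr !(mulrA (z ^+ 2)) (mulrDr (z ^+ 2) (8%:R * k * B')).
  by rewrite (z2C (8%:R * k)) (z2C (24%:R * k ^+ 2)).
rewrite z2C coefC coefB coefA.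
ncring [:: k; f; p; g; y; Y; x; X; A]
  (cf y, cf Y, cp y, cp Y, cg y, cg Y, Yy, cf X, cp X, cg X, ck y, ck Y, ck X,
   Xy, XY, ck f, ck p, ck g, xy, xY, Xx, ck x, cf x, cp x, cg x,
   ck A, cf A, cp A, cg A, commAX, commAY, commAx, commAy).
Qed.

Lemma discriminantE :
  2%:R * (f * g) = 2%:R * p ^+ 2
    + (2%:R * (A * C) - 2%:R * B ^+ 2 - 4%:R * k * A * B
       + 6%:R * k ^+ 2 * A ^+ 2) * z ^+ 2.
Proof.
have cz2 a : a * z ^+ 2 = z ^+ 2 * a.
  by rewrite expr2 mulrA cz (cz a) mulrA.
rewrite cz2; apply: (addrI (- (2%:R * p ^+ 2))); rewrite addKr.
(* In this form the left factor of each term is one for which z^2 times it is known; the right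
   factors A, B, C then reassemble to f, g and 2 p. *)
have -> : 2%:R * (A * C) - 2%:R * B ^+ 2 - 4%:R * k * A * B
       + 6%:R * k ^+ 2 * A ^+ 2 =
  A * C + (C + 6%:R * k * B + 6%:R * k ^+ 2 * A) * A
  - 2%:R * ((B + k * A) * B).
  ncring [:: k; A; B; C] (ck A, ck B, ck C, commBA, commCA).
rewrite mulrBr mulrDr (z2C 2%:R) !(mulrA (z ^+ 2)) coefA coefB coefC.
have -> : - (2%:R * p ^+ 2) + 2%:R * (f * g) = f * g + g * f - p * (2%:R * p).
  ncring [:: f; g; p] (cf g).
rewrite [in LHS]ep {1}eg {2}ef.
ncring [:: k; f; p; g; y; Y; x; X; A; B; C] (Yy).
Qed.

(** The second hypothesis is E applied to the right side of [coefA]; up to a multiple of z^2 A its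
    left side is - 2 z^2 (B + k A). *)
Lemma coefB_eq0 :
  A = 0 ->
  f * (X * Y + Y * X) - 2%:R * p * (x * Y + y * X) + g * (x * y + y * x) = 0 ->
  B = 0.
Proof.
move=> A0 E; apply: cancel_z2; rewrite mulr0.
suff: 2%:R * (z ^+ 2 * (B + k * A)) = 2%:R * 0.
  by move/(domD_cancel two_neq0); rewrite A0 mulr0 addr0.
rewrite coefB mulr0 -[RHS]oppr0 -E; apply: (addIr (2%:R * k * (z ^+ 2 * A))).
rewrite {2}A0 !mulr0 addr0 coefA.
ncring [:: k; f; p; g; y; Y; x; X] (Yy, xY, xy, Xy, XY, ck f, ck p, ck g).
Qed.

(** The same with E applied to the right side of [coefB]; the factors X + 2 k Y and x + 2 k y are
    e^(hF) X and e^(hF) x. *)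
Lemma coefC_eq0 :
  A = 0 -> B = 0 ->
  p * ((X + 2%:R * k * Y) * x + (x + 2%:R * k * y) * X)
    - f * ((X + 2%:R * k * Y) * X) - g * ((x + 2%:R * k * y) * x) = 0 ->
  C = 0.
Proof.
move=> A0 B0 E; apply: cancel_z2; rewrite mulr0.
have := coefC; rewrite {1}A0 B0 !mulr0 !addr0 => ->.
rewrite -[RHS]oppr0 -E; apply/eqP; rewrite -subr_eq0; apply/eqP.
transitivity (2%:R * k * (z ^+ 2 * (B + k * A)) + 4%:R * k ^+ 2 * (z ^+ 2 * A)).
  rewrite coefB coefA.
  ncring [:: k; f; p; g; y; Y; x; X] (Yy, xY, xy, Xy, XY, ck f, ck p, ck g, cp X, cp x).
by rewrite A0 B0 !mulr0 !addr0 !mulr0.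
Qed.

End QuadraticForm.

(** * Exponentials of locally nilpotent operators *)

Section LocallyNilpotent.
Variables (R : realType) (V : lmodType R[i]) (T : {linear V -> V}).
Hypothesis nilpT : forall v, exists n, iter n T v = 0.

Lemma iter_linear0 n : iter n T 0 = 0.
Proof. by elim: n => //= n ->; rewrite linear0. Qed.

Lemma iter_nilp_le m n v : (m <= n)%N -> iter m T v = 0 -> iter n T v = 0.
Proof. by move=> /subnK <- Tm0; rewrite iterD Tm0 iter_linear0. Qed.

Lemma expop_fin (t : R[i]) n v : iter n T v = 0 ->
  expop T t v = \sum_(k < n) (t ^+ k / k`!%:R) *: iter k T v.
Proof.
move=> Tn0; rewrite /expop.
rewrite (fsbig_ord _ _ (fun k => (t ^+ k / k`!%:R) *: iter k T v)).
apply/esym/fsbig_widen => // k [_ /= /negP]; rewrite -leqNgt => nk.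
by rewrite (iter_nilp_le nk) ?scaler0.
Qed.

Lemma iterTD n : {morph iter n T : u v / u + v}.
Proof. by move=> u v; elim: n => //= n ->; rewrite linearD. Qed.

Lemma iterTZ n c : {morph iter n T : v / c *: v}.
Proof. by move=> v; elim: n => //= n ->; rewrite linearZ. Qed.

Lemma common_nilp u v : exists n, iter n T u = 0 /\ iter n T v = 0.
Proof.
have [m um] := nilpT u; have [n vn] := nilpT v; exists (maxn m n).
by split; [apply: iter_nilp_le um | apply: iter_nilp_le vn];
  rewrite ?leq_maxl ?leq_maxr.
Qed.

Lemma expop_is_linear t c u v :
  expop T t (c *: u + v) = c *: expop T t u + expop T t v.
Proof.
have [n [un vn]] := common_nilp u v.
rewrite (@expop_fin t n) ?(@expop_fin t n u) ?(@expop_fin t n v) //; last first.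
  by rewrite iterTD iterTZ un vn scaler0 addr0.
rewrite scaler_sumr -big_split; apply: eq_bigr => k _ /=.
by rewrite iterTD iterTZ scalerDr !scalerA mulrC.
Qed.

Lemma sinhop_is_linear t c u v :
  sinhop T t (c *: u + v) = c *: sinhop T t u + sinhop T t v.
Proof.
rewrite /sinhop !expop_is_linear opprD addrACA -scalerBr scalerDr !scalerA.
by rewrite mulrC.
Qed.

Lemma expop_ker t v : T v = 0 -> expop T t v = v.
Proof.
by move=> Tv; rewrite (@expop_fin t 1) // big_ord1 /= expr0 fact0 divr1 scale1r.
Qed.

Lemma expop_ker2 t v : T (T v) = 0 -> expop T t v = v + t *: T v.
Proof.
move=> Tv; rewrite (@expop_fin t 2) // big_ord_recl big_ord1 /=.
by rewrite expr0 fact0 divr1 scale1r expr1 divr1.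
Qed.

Lemma expop_commute (S : {linear V -> V}) t v :
  (forall u, S (T u) = T (S u)) -> S (expop T t v) = expop T t (S v).
Proof.
move=> ST; have iST k u : S (iter k T u) = iter k T (S u).
  by elim: k => //= k <-.
have [n vn] := nilpT v.
rewrite !(@expop_fin t n) // -?iST ?vn ?linear0 // linear_sum.
by apply: eq_bigr => k _; rewrite linearZ /= iST.
Qed.

End LocallyNilpotent.

Section ExpDerivation.
Variables (R : realType) (A : algType R[i]) (F : {linear A -> A}).
Hypothesis nilpF : forall v, exists n, iter n F v = 0.
Hypothesis FM : forall a b, F (a * b) = F a * b + a * F b.

Let dp n a : A := n`!%:R^-1 *: iter n F a.

Lemma dividedS n a : n.+1%:R *: dp n.+1 a = F (dp n a).
Proof.
rewrite /dp [in RHS]linearZ /= scalerA factS natrM invfM mulrA divff ?mul1r //.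
by rewrite pnatr_eq0.
Qed.

Lemma divided_derivM n a b :
  dp n (a * b) = \sum_(i < n.+1) dp i a * dp (n - i) b.
Proof.
elim: n => [|n ih]; first by rewrite big_ord1 /dp /= !fact0 invr1 !scale1r.
have n1_neq0 : n.+1%:R != 0 :> R[i] by rewrite pnatr_eq0.
apply: (scalerI n1_neq0); rewrite dividedS ih linear_sum /= scaler_sumr.
(* The factor n + 1 splits as i + (n + 1 - i), according to which factor F is applied to. *)
transitivity (\sum_(i < n.+2) i%:R *: (dp i a * dp (n.+1 - i) b)
  + \sum_(i < n.+2) (n.+1 - i)%:R *: (dp i a * dp (n.+1 - i) b)).
  rewrite [in RHS]big_ord_recl /= scale0r add0r.
  rewrite [X in _ = _ + X]big_ord_recr /= subnn scale0r addr0 -big_split /=.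
  apply: eq_bigr => i _; rewrite FM -!dividedS /bump /= add1n subSS.
  by rewrite subSn ?leq_ord // -scalerAl; congr (_ + _); rewrite scalerAr.
rewrite -big_split; apply: eq_bigr => i _ /=.
by rewrite -scalerDl -natrD subnKC // -ltnS.
Qed.

Lemma divided0 m n a : (m <= n)%N -> iter m F a = 0 -> dp n a = 0.
Proof. by move=> mn Fa; rewrite /dp (iter_nilp_le mn Fa) scaler0. Qed.

Lemma expop_horner t m a : iter m F a = 0 ->
  expop F t a = (\poly_(i < m) dp i a).[t%:A].
Proof.
move=> Fa; rewrite (expop_fin t Fa) horner_poly; apply: eq_bigr => i _.
by rewrite -in_algE -rmorphXn /= mulr_algr scalerA.
Qed.

(** By [divided_derivM], the divided powers of F on a b are the coefficients of a product of two
    polynomials, and evaluation at a central scalar is multiplicative. *)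
Lemma expopM t a b : expop F t (a * b) = expop F t a * expop F t b.
Proof.
have [m [am bm]] := common_nilp nilpF a b.
have [n abn] := nilpF (a * b).
rewrite (expop_horner t am) (expop_horner t bm) (expop_horner t abn).
rewrite -hornerM_comm; last first.
  by apply: commr_polyX || rewrite /comm_poly mulr_algl mulr_algr.
congr (_.[_]); apply/polyP => i; rewrite coefM coef_poly.
have dpE c k j : iter k F c = 0 -> (if (j < k)%N then dp j c else 0) = dp j c.
  by move=> Fc; case: ltnP => // kj; rewrite (divided0 kj Fc).
rewrite dpE // divided_derivM; apply: eq_bigr => j _.
by rewrite !coef_poly !dpE.
Qed.

End ExpDerivation.

(** * The algebra H_I and the action of U_h(sl(2)) *)

Section Subalgebra.
Variables (K : fieldType) (A : algType K) (S : {pred A}).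
Hypothesis S_closed : GRing.subalg_closed S.

HB.instance Definition _ := GRing.isSubalgClosed.Build K A S S_closed.
(* The closure hypothesis is an argument so that the instances can be found   *)
(* outside the section.                                                       *)
Definition subalg_of (_ : GRing.subalg_closed S) : predArgType :=
  {a : A | a \in S}.
Notation subalg := (subalg_of S_closed).
HB.instance Definition _ := SubChoice.on subalg.
HB.instance Definition _ := [SubChoice_isSubAlgebra of subalg by <:].

Definition subalg_incl (u : subalg) : A := val u.
HB.instance Definition _ :=
  GRing.RMorphism.copy subalg_incl (val : subalg -> A).
HB.instance Definition _ := GRing.Linear.copy subalg_incl (val : subalg -> A).

(** Turns a closed predicate into an algebra to which the universal property of H_I can be
    applied. *)
Lemma exists_subalg : exists (B : algType K) (inc : {lrmorphism B -> A}),
  [/\ injective inc, forall b, inc b \in S &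
      forall a, a \in S -> exists b, inc b = a].
Proof.
exists subalg, subalg_incl; split; [exact: val_inj | by move=> b; apply: valP |].
by move=> a aS; exists (Sub a aS); apply: SubK.
Qed.

End Subalgebra.

Section Relations.
Variables (R : realType) (h : R[i]) (d : Order.disp_t) (I : orderType d).

Record HI_symmetric_relations (A : algType R[i]) (x y : I -> A) : Prop := {
  HI_sxy : forall i j, x i * y j = y j * x i + h *: (y i * y j);
  HI_syy : forall i j, y i * y j = y j * y i;
  HI_sxx : forall i j,
    x i * x j = x j * x i - h *: (y i * x j) + h *: (y j * x i) }.

(* Scalars are turned into central elements of the ring, as the tactic        *)
(* ncring only knows rings.                                                   *)
Lemma scalar_central (A : algType R[i]) (c : R[i]) :
  exists2 H : A, (forall a, c *: a = H * a) & (forall a, a * H = H * a).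
Proof.
by exists c%:A => a; rewrite ?mulr_algl // mulr_algr.
Qed.

(** The order of I disappears from the symmetric form, which makes relabelling of indices in
    [HI_swap] possible. *)
Lemma HI_relationsE (A : algType R[i]) (x y : I -> A) :
  HI_relations h x y <-> HI_symmetric_relations x y.
Proof.
have [H hE cH] := scalar_central A h.
have h2E a : h ^+ 2 *: a = H * (H * a) by rewrite expr2 -scalerA !hE.
split=> [[rxy rxjyi ryjxi ryjyi rxjxi]|[rxy ryy rxx]].
  have ryy i j : y i * y j = y j * y i.
    by have [ij|ij|->] := ltgtP i j; rewrite // ?(ryjyi _ _ ij).
  have rxy' i j : x i * y j = y j * x i + h *: (y i * y j).
    have [ij|ij|->] := ltgtP i j.
    - by rewrite (ryjxi _ _ ij) subrK.
    - by rewrite (rxjyi _ _ ij) ryy.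
    - by rewrite rxy expr2.
  split=> // i j.
  have rxx k l : (k < l)%O ->
      x l * x k = x k * x l - h *: (y l * x k) + h *: (y k * x l).
    move=> kl; rewrite (rxjxi _ _ kl) !hE h2E.
    have := rxy' k l; have := ryy l k; rewrite hE => yy xy.
    ncring [:: H; y k; y l; x k; x l] (xy, yy, cH (y k)).
  have [ij|ij|->] := ltgtP i j; last by rewrite subrK.
    by rewrite (rxx _ _ ij) addrK subrK.
  exact: rxx.
split=> [i|i j ij|i j ij|i j ij|i j ij].
- by rewrite rxy expr2.
- by rewrite rxy ryy.
- by rewrite rxy addrK.
- exact: ryy.
rewrite rxx !hE h2E; have := rxy i j; have := ryy j i; rewrite hE => yy xy.
ncring [:: H; y i; y j; x i; x j] (xy, yy, cH (y i)).
Qed.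

(* D is an Euler operator giving v degree 1 and u degree -1.                  *)
Lemma HI_relations_euler (A : algType R[i]) (u v : I -> A) (D : A) :
  (forall i j, u i * u j = u j * u i) -> (forall i j, v i * v j = v j * v i) ->
  (forall i j, u i * v j = v j * u i) ->
  (forall i, D * u i = u i * D - u i) -> (forall i, D * v i = v i * D + v i) ->
  HI_relations h (fun i => h *: (v i * D) + u i) v.
Proof.
move=> uu vv uv Du Dv; apply/HI_relationsE.
have [H hE cH] := scalar_central A h.
split=> // i j; rewrite !hE.
  ncring [:: H; v i; v j; u i; D]
    (uv i j, vv j i, Dv j, cH (v i), cH (v j), cH (u i)).
ncring [:: H; v i; v j; u i; u j; D]
  (uu j i, uv i i, uv i j, uv j i, uv j j, vv j i, Dv i, Dv j, Du i, Du j,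
   cH (v i), cH (v j), cH (u i), cH (u j), cH D).
Qed.

End Relations.

Section Presentation.
Variables (R : realType) (h : R[i]) (d : Order.disp_t) (I : orderType d).
Variables (HI : algType R[i]) (gx gy : I -> HI).
Hypothesis HI_pres : presents_HI h gx gy.

(** The universal map into the subalgebra followed by inclusion fixes the generators, so it is the
    identity by uniqueness. *)
Lemma HI_generated (S : {pred HI}) :
  GRing.subalg_closed S -> (forall i, gx i \in S /\ gy i \in S) ->
  forall a, a \in S.
Proof.
move=> S_closed gS a; have [rel univ] := HI_pres.
have [B [inc [inc_inj incS inc_surj]]] := exists_subalg S_closed.
have /choice[x' x'E] i : exists b : B, inc b = gx i.
  by apply: inc_surj; case: (gS i).
have /choice[y' y'E] i : exists b : B, inc b = gy i.
  by apply: inc_surj; case: (gS i).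
have rel' : HI_relations h x' y'.
  move: rel => /HI_relationsE[rxy ryy rxx].
  apply/HI_relationsE; split=> i j; apply: inc_inj.
  - by rewrite linearD linearZ /= !rmorphM /= !(x'E, y'E) rxy.
  - by rewrite !rmorphM /= !y'E ryy.
  - rewrite linearD linearB !linearZ /= !rmorphM /= !(x'E, y'E).
    by rewrite scalerN rxx.
have [phi [phi_gen _]] := univ B x' y' rel'.
have [psi [_ psi_uniq]] := univ HI gx gy rel.
have -> : a = inc (phi a).
  transitivity (psi a).
    by apply: (psi_uniq idfun).
  apply/esym; apply: (psi_uniq (inc \o phi)) => i /=.
  by have [-> ->] := phi_gen i; rewrite x'E y'E.
exact: incS.
Qed.

Lemma HI_swap (i0 i1 : I) : i0 != i1 ->
  exists phi : {lrmorphism HI -> HI},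
    [/\ phi (gx i1) = gx i0, phi (gy i1) = gy i0 &
      forall i, i != i0 -> i != i1 -> phi (gx i) = gx i /\ phi (gy i) = gy i].
Proof.
move=> i01; have [/HI_relationsE rel univ] := HI_pres.
pose sw i := if i == i1 then i0 else if i == i0 then i1 else i.
have rel' : HI_relations h (gx \o sw) (gy \o sw).
  by apply/HI_relationsE; case: rel => rxy ryy rxx; split=> i j /=.
have [phi [phi_gen _]] := univ _ _ _ rel'; exists phi; split.
- by have [-> _] := phi_gen i1; rewrite /= /sw eqxx.
- by have [_ ->] := phi_gen i1; rewrite /= /sw eqxx.
move=> i /negPf ii0 /negPf ii1.
by have [-> ->] := phi_gen i; rewrite /= /sw ii0 ii1.
Qed.

(* The algebra C[al, be]/(al^2, be^2) with its Euler operator, in the basis   *)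
(* 1, al, be, al be.                                                          *)
Lemma bracket_neq0 (i0 i1 : I) : i0 != i1 ->
  bracket h gx gy i0 i1 != 0 /\ gy i1 != 0.
Proof.
move=> i01; have [_ univ] := HI_pres.
pose e (a b : 'I_4) : 'M[R[i]]_4 := delta_mx a b.
have eM a b a' b' : e a b * e a' b' = (e a b') *+ (b == a').
  by rewrite /e -[LHS]/(_ *m _) mul_delta_mx_cond.
pose o0 := @Ordinal 4 0 isT; pose o1 := @Ordinal 4 1 isT.
pose o2 := @Ordinal 4 2 isT; pose o3 := @Ordinal 4 3 isT.
pose al := e o1 o0 + e o3 o2; pose be := e o2 o0 + e o3 o1.
pose D := e o2 o2 - e o1 o1.
have Dal : D * al = al * D - al.
  rewrite /D /al !(mulrDl, mulrDr, mulrN, mulNr) !eM !eqE /=.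
  by rewrite !mulr0n !mulr1n !(oppr0, addr0, add0r) opprD addrC subrK.
have Dbe : D * be = be * D + be.
  rewrite /D /be !(mulrDl, mulrDr, mulrN, mulNr) !eM !eqE /=.
  by rewrite !mulr0n !mulr1n !(oppr0, addr0, add0r) addrC addrK.
have albe : al * be = e o3 o0.
  rewrite /al /be !(mulrDl, mulrDr, mulrN, mulNr) !eM !eqE /=.
  by rewrite !mulr0n !mulr1n !(oppr0, addr0, add0r).
have beal : be * al = e o3 o0.
  rewrite /al /be !(mulrDl, mulrDr, mulrN, mulNr) !eM !eqE /=.
  by rewrite !mulr0n !mulr1n !(oppr0, addr0, add0r).
have e_neq0 : e o3 o0 != 0.
  by apply/eqP => /matrixP/(_ o3 o0)/eqP; rewrite !mxE !eqxx /= oner_eq0.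
pose c (i : I) : R[i] := (i == i0)%:R; pose c' (i : I) : R[i] := (i == i1)%:R.
(* Here x_0 acts as [al], y_0 as 0 and y_1 as [be], so that (01) acts as [al * be]. *)
have rel : HI_relations h (fun i => h *: (c' i *: be * D) + c i *: al)
                          (fun i => c' i *: be).
  apply: HI_relations_euler => [i j|i j|i j|i|i].
  - by rewrite -!(scalerAl, scalerAr) !scalerA mulrC.
  - by rewrite -!(scalerAl, scalerAr) !scalerA mulrC.
  - by rewrite -!(scalerAl, scalerAr) !scalerA mulrC albe beal.
  - by rewrite -scalerAl -scalerAr Dal scalerBr.
  - by rewrite -scalerAl -scalerAr Dbe scalerDr.
have [phi [phi_gen _]] := univ _ _ _ rel.
have [phix0 phiy0] := phi_gen i0; have [phix1 phiy1] := phi_gen i1.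
have c00 : c i0 = 1 by rewrite /c eqxx.
have c'11 : c' i1 = 1 by rewrite /c' eqxx.
have c'01 : c' i0 = 0 by rewrite /c' (negPf i01).
split; apply/eqP => /(congr1 phi)/eqP.
  rewrite /bracket !linearB linearZ /= !rmorphM rmorph0 /=.
  rewrite phix0 phiy0 phiy1 c00 c'11 c'01 !scale0r !mul0r !scaler0 add0r !subr0.
  by rewrite !scale1r albe (negPf e_neq0).
rewrite phiy1 c'11 scale1r rmorph0 => /eqP be0.
by rewrite -albe be0 mulr0 eqxx in e_neq0.
Qed.

End Presentation.

Section Induction.
Variables (R : realType) (h : R[i]) (d : Order.disp_t) (I : orderType d).
Variables (HI : algType R[i]) (gx gy : I -> HI).

Lemma subalg_closed_asbool (A : algType R[i]) (P : A -> Prop) :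
  P 1 -> (forall c a b, P a -> P b -> P (c *: a + b)) ->
  (forall a b, P a -> P b -> P (a * b)) ->
  GRing.subalg_closed [pred a | `[< P a >]].
Proof.
move=> P1 PZD PM.
have inP a : (a \in [pred a | `[< P a >]]) = `[< P a >] by [].
split=> [|c a b|a b]; rewrite !inP; first exact/asboolP.
  by move=> /asboolP Pa /asboolP Pb; apply/asboolP/PZD.
by move=> /asboolP Pa /asboolP Pb; apply/asboolP/PM.
Qed.

Lemma HI_ind (HI_pres : presents_HI h gx gy) (P : HI -> Prop) :
  P 1 -> (forall c a b, P a -> P b -> P (c *: a + b)) ->
  (forall a b, P a -> P b -> P (a * b)) -> (forall i, P (gx i) /\ P (gy i)) ->
  forall a, P a.
Proof.
move=> P1 PZD PM Pg a; apply/asboolP.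
apply: (HI_generated HI_pres (subalg_closed_asbool P1 PZD PM)) => i.
by have [? ?] := Pg i; split; exact: asboolT.
Qed.

Lemma HJ_ind (J : {pred I}) (P : HI -> Prop) :
  P 1 -> (forall c a b, P a -> P b -> P (c *: a + b)) ->
  (forall a b, P a -> P b -> P (a * b)) ->
  (forall i, i \in J -> P (gx i) /\ P (gy i)) ->
  forall a, HJ gx gy J a -> P a.
Proof.
move=> P1 PZD PM Pg a aJ; apply/asboolP.
apply: (aJ _ (subalg_closed_asbool P1 PZD PM)) => i iJ.
by have [? ?] := Pg i iJ; split; exact: asboolT.
Qed.

Lemma HJ_gen (J : {pred I}) i : i \in J -> HJ gx gy J (gx i) /\ HJ gx gy J (gy i).
Proof. by move=> iJ; split=> S _ /(_ i iJ)[]. Qed.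

Lemma HJ_lin (J : {pred I}) c a b :
  HJ gx gy J a -> HJ gx gy J b -> HJ gx gy J (c *: a + b).
Proof.
by move=> aJ bJ S SP gS; have [_ SZ _] := SP; apply: SZ; [apply: aJ|apply: bJ].
Qed.

Lemma HJM (J : {pred I}) a b :
  HJ gx gy J a -> HJ gx gy J b -> HJ gx gy J (a * b).
Proof.
by move=> aJ bJ S SP gS; have [_ _ SM] := SP; apply: SM; [apply: aJ|apply: bJ].
Qed.

Lemma HJ0 (J : {pred I}) : HJ gx gy J 0.
Proof.
move=> S SP gS; have [S1 SZ _] := SP; rewrite -(addNr (1 : HI)) -scaleN1r.
exact: SZ.
Qed.

Lemma HJZ (J : {pred I}) c a : HJ gx gy J a -> HJ gx gy J (c *: a).
Proof. by move=> aJ; rewrite -[_ *: _]addr0; apply/HJ_lin/HJ0. Qed.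

Lemma HJD (J : {pred I}) a b :
  HJ gx gy J a -> HJ gx gy J b -> HJ gx gy J (a + b).
Proof. by move=> aJ bJ; rewrite -[a]scale1r; apply: HJ_lin. Qed.

Lemma HJ_sub (J J' : {pred I}) a :
  {subset J <= J'} -> HJ gx gy J a -> HJ gx gy J' a.
Proof. by move=> JJ' aJ S SP gS; apply: aJ => // i /JJ'/gS. Qed.

Lemma HJ_homogeneous0 (J : {pred I}) i0 a :
  i0 \notin J -> HJ gx gy J a -> homogeneous gx gy i0 0 a.
Proof.
move=> i0J; apply: HJ_ind => [|c u v hu hv|u v|i iJ].
- by rewrite -[1]scale1r; apply: homog_scalar.
- apply: homog_add => //; rewrite -mulr_algl.
  exact: (homog_mul (homog_scalar _ _ _ c) hu).
- exact: homog_mul.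
have i_i0 : (i == i0 : nat) = 0%N.
  by case: eqP => // ii0; rewrite -ii0 iJ in i0J.
by split; rewrite -i_i0; [apply: homog_x | apply: homog_y].
Qed.

End Induction.

(** * Generators, the action, and centrality of invariants *)

Section Action.
Variables (R : realType) (h : R[i]) (d : Order.disp_t) (I : orderType d).
Variables (HI : algType R[i]) (gx gy : I -> HI) (E F H : {linear HI -> HI}).
Hypothesis HI_pres : presents_HI h gx gy.
Hypothesis HI_act : HI_action h gx gy E F H.

Lemma F_nilp v : exists n, iter n F v = 0.
Proof. exact: (Uh_F_nilp (Uh_mod HI_act.1)). Qed.

Lemma actE1 : [/\ E 1 = 0, F 1 = 0 & H 1 = 0].
Proof. exact: (Uh_unit HI_act.1). Qed.

Lemma F_derivation a b : F (a * b) = F a * b + a * F b.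
Proof. exact: (Uh_MF HI_act.1). Qed.

Lemma expF_y t i : expop F t (gy i) = gy i.
Proof. by apply: expop_ker; have [_ _ []] := HI_act.2 i. Qed.

Lemma expF_x t i : expop F t (gx i) = gx i + t *: gy i.
Proof.
by have [_ _ [Fx Fy]] := HI_act.2 i; rewrite expop_ker2 Fx // Fy.
Qed.

Lemma expF_inv t a : F a = 0 -> expop F t a = a.
Proof. exact: expop_ker. Qed.

(** The exponential is multiplicative, so the rule passes from generators to products. *)
Lemma y_commute j a : gy j * a = expop F (- h) a * gy j.
Proof.
have [/HI_relationsE[rxy ryy _] _] := HI_pres.
elim/(HI_ind HI_pres): a => [|c a b iha ihb|a b iha ihb|i].
- by have [_ F1 _] := actE1; rewrite expF_inv // mul1r mulr1.
- rewrite (expop_is_linear F_nilp) mulrDr mulrDl.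
  by rewrite -scalerAr -scalerAl iha ihb.
- rewrite (expopM F_nilp F_derivation) mulrA iha.
  by rewrite -[LHS]mulrA ihb mulrA.
split; last by rewrite expF_y ryy.
by rewrite expF_x mulrDl scaleNr mulNr rxy -scalerAl addrK.
Qed.

(** Like H, the operator h (sinh(hF) - H) is a derivation twisted by e^(hF) and e^(-hF); this
    carries the rule over to products. *)
Lemma x_commute j a : gx j * a =
  expop F h a * gx j + (h *: (sinhop F h a - H a)) * gy j.
Proof.
have [/HI_relationsE[rxy ryy rxx] _] := HI_pres.
have half (v : HI) : 2^-1 *: (v + v) = v.
  by rewrite -mulr2n -[v *+ 2]scaler_nat scalerA mulVf ?scale1r // pnatr_eq0.
elim/(HI_ind HI_pres): a => [|c a b iha ihb|a b iha ihb|i].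
- have [_ F1 H1] := actE1; rewrite /sinhop !expF_inv // H1 !subrr.
  by rewrite !scaler0 subr0 scaler0 mul0r addr0 mul1r mulr1.
- have -> : h *: (sinhop F h (c *: a + b) - H (c *: a + b)) =
      c *: (h *: (sinhop F h a - H a)) + h *: (sinhop F h b - H b).
    rewrite (sinhop_is_linear F_nilp) linearP opprD addrACA -scalerBr.
    by rewrite scalerDr !scalerA (mulrC h).
  rewrite (expop_is_linear F_nilp) mulrDr !mulrDl -!scalerAl -scalerAr iha ihb.
  by rewrite scalerDr addrACA -!scalerAl.
- have -> : h *: (sinhop F h (a * b) - H (a * b)) =
      expop F h a * (h *: (sinhop F h b - H b))
      + (h *: (sinhop F h a - H a)) * expop F (- h) b.
    rewrite -scalerAr -scalerAl -scalerDr; congr (_ *: _).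
    rewrite /sinhop !(expopM F_nilp F_derivation) (Uh_MH HI_act.1).
    rewrite mulrBr mulrBl -scalerAl -scalerAr mulrBl mulrBr !scalerBr.
    set u := 2^-1 *: (_ * expop F h b); set v := 2^-1 *: _.
    set w := _ * H b; set w' := H a * _; set z := 2^-1 *: _.
    rewrite addrACA -opprD [w + w']addrC; congr (_ - _).
    by rewrite addrA subrK.
  rewrite mulrA iha mulrDl -!mulrA ihb y_commute mulrDr.
  by rewrite (expopM F_nilp F_derivation) mulrDl !mulrA addrA.
have [[Hx Hy] _ [Fx Fy]] := HI_act.2 i.
split; rewrite /sinhop ?expF_x ?expF_y ?Hx ?Hy.
  rewrite scaleNr opprD opprK addrACA subrr add0r half.
  have [c cE cC] := scalar_central HI h; rewrite !cE.
  have := rxx j i; have := rxy i j; rewrite !cE => xy xx.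
  ncring [:: c; gy i; gy j; gx i; gx j]
    (xx, xy, ryy j i, cC (gx i), cC (gx j), cC (gy i), cC (gy j)).
by rewrite subrr scaler0 sub0r opprK rxy -scalerAl [gy j * _]ryy.
Qed.

Lemma invariant_central a b : F a = 0 -> H a = 0 -> b * a = a * b.
Proof.
move=> Fa Ha; elim/(HI_ind HI_pres): b => [|c u v ihu ihv|u v ihu ihv|i].
- by rewrite mul1r mulr1.
- by rewrite mulrDr mulrDl -scalerAl -scalerAr ihu ihv.
- by rewrite -mulrA ihv mulrA ihu mulrA.
split; last by rewrite y_commute expF_inv.
by rewrite x_commute /sinhop !expF_inv // Ha subr0 subrr !scaler0 mul0r addr0.
Qed.

Lemma E_mulr_inv a b : invariants E F H b -> E (a * b) = E a * b.
Proof.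
by case=> Eb Fb Hb; rewrite (Uh_ME HI_act.1) Eb mulr0 addr0 expF_inv.
Qed.

Lemma invariants_lin c a b : invariants E F H a -> invariants E F H b ->
  invariants E F H (c *: a + b).
Proof.
move=> [Ea Fa Ha] [Eb Fb Hb].
by split; rewrite linearP ?Ea ?Fa ?Ha ?Eb ?Fb ?Hb scaler0 addr0.
Qed.

Lemma bracket_invariant i j : invariants E F H (bracket h gx gy i j).
Proof.
have [[Hxi Hyi] [Exi Eyi] [Fxi Fyi]] := HI_act.2 i.
have [[Hxj Hyj] [Exj Eyj] [Fxj Fyj]] := HI_act.2 j.
have [c cE cC] := scalar_central HI h.
rewrite /bracket; split; rewrite !linearB linearZ /=.
- rewrite !(Uh_ME HI_act.1) !expF_x !expF_y Exi Eyi Exj Eyj scaleNr !cE.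
  ncring [:: c; gy i; gy j; gx i; gx j]
    (cC (gx i), cC (gx j), cC (gy i), cC (gy j)).
- rewrite !F_derivation Fxi Fyi Fxj Fyj !(mul0r, mulr0, addr0, add0r).
  by rewrite scaler0 subrr subr0.
rewrite !(Uh_MH HI_act.1) !expF_x !expF_y Hxi Hyi Hxj Hyj scaleNr !cE.
ncring [:: c; gy i; gy j; gx i; gx j]
  (cC (gx i), cC (gx j), cC (gy i), cC (gy j)).
Qed.

(** * Polarization commutes with the action *)

Section Polarization.
Variables (i0 i1 : I) (Delta : {linear HI -> HI}).
Hypothesis DeltaP : is_polar_derivation gx gy i0 i1 Delta.

Lemma Delta_derivation a b : Delta (a * b) = Delta a * b + a * Delta b.
Proof. by case: DeltaP. Qed.

Lemma Delta1 : Delta 1 = 0.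
Proof.
apply: (addrI (Delta 1)).
by rewrite addr0 -[in RHS](mulr1 1) Delta_derivation mul1r mulr1.
Qed.

Lemma Delta_gen i : (Delta (gx i) = gx i1 /\ Delta (gy i) = gy i1) \/
  (Delta (gx i) = 0 /\ Delta (gy i) = 0).
Proof.
have [_ [Dx Dy] D0] := DeltaP; case: (eqVneq i i0) => [->|]; first by left.
by right; apply: D0.
Qed.

(** On generators, [Delta] replaces the index by [i1] or gives 0, and F acts alike for all indices.
    The Leibniz rules extend this to products. *)
Lemma Delta_F a : Delta (F a) = F (Delta a).
Proof.
have [_ F1 _] := actE1.
elim/(HI_ind HI_pres): a => [|c a b iha ihb|a b iha ihb|i].
- by rewrite F1 Delta1 !linear0.
- by rewrite !linearP iha ihb.
- rewrite F_derivation Delta_derivation !linearD /= !Delta_derivation.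
  by rewrite !F_derivation iha ihb addrACA.
have [_ _ [-> ->]] := HI_act.2 i; have [_ _ [Fx1 Fy1]] := HI_act.2 i1.
by case: (Delta_gen i) => -[-> ->]; rewrite ?Fx1 ?Fy1 !linear0.
Qed.

(** Needed for the twisted Leibniz rules of E and H. *)
Lemma Delta_expF t a : Delta (expop F t a) = expop F t (Delta a).
Proof. exact: (expop_commute F_nilp) Delta_F. Qed.

Lemma Delta_E a : Delta (E a) = E (Delta a).
Proof.
have [E1 _ _] := actE1.
elim/(HI_ind HI_pres): a => [|c a b iha ihb|a b iha ihb|i].
- by rewrite E1 Delta1 !linear0.
- by rewrite !linearP iha ihb.
- rewrite (Uh_ME HI_act.1) !Delta_derivation !linearD /= !(Uh_ME HI_act.1).
  by rewrite !Delta_derivation !Delta_expF iha ihb addrACA.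
have [_ [-> ->] _] := HI_act.2 i; have [_ [Ex1 Ey1] _] := HI_act.2 i1.
by case: (Delta_gen i) => -[-> ->]; rewrite ?Ex1 ?Ey1 !linear0.
Qed.

Lemma Delta_H a : Delta (H a) = H (Delta a).
Proof.
have [_ _ H1] := actE1.
elim/(HI_ind HI_pres): a => [|c a b iha ihb|a b iha ihb|i].
- by rewrite H1 Delta1 !linear0.
- by rewrite !linearP iha ihb.
- rewrite (Uh_MH HI_act.1) !Delta_derivation !linearD /= !(Uh_MH HI_act.1).
  by rewrite !Delta_derivation !Delta_expF iha ihb addrACA.
have [[-> ->] _ _] := HI_act.2 i; have [[Hx1 Hy1] _ _] := HI_act.2 i1.
by rewrite linearN; case: (Delta_gen i) => -[-> ->]; rewrite ?Hx1 ?Hy1 ?linear0 ?oppr0.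
Qed.

Lemma Delta_invariant a : invariants E F H a -> invariants E F H (Delta a).
Proof.
by move=> [Ea Fa Ha]; split; rewrite -?Delta_E -?Delta_F -?Delta_H ?Ea ?Fa ?Ha linear0.
Qed.

Lemma Delta_HJ (J : {pred I}) a : i0 \notin J -> HJ gx gy J a -> Delta a = 0.
Proof.
move=> i0J; apply: (HJ_ind (P := fun u => Delta u = 0)) => [|c u v Du Dv|u v Du Dv|i iJ].
- exact: Delta1.
- by rewrite linearP Du Dv scaler0 addr0.
- by rewrite Delta_derivation Du Dv mul0r mulr0 addr0.
by have [_ _ D0] := DeltaP; apply: D0; apply: contraNneq i0J => <-.
Qed.

End Polarization.
End Action.

(** * Forms in H_I and their factorization *)

Section Factorization.
Variables (D : nzRingType) (k x y X Y A B C p t : D).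
Hypothesis two_reg : forall a b : D, 2%:R * a = 2%:R * b -> a = b.
Hypothesis ck : forall a, a * k = k * a.
Hypothesis ct : forall a, a * t = t * a.
Hypothesis Xy : X * y = y * X + 2%:R * k * y * Y.
Hypothesis Xx : X * x = x * X - 2%:R * k * Y * x + 2%:R * k * y * X.
Hypothesis xY : x * Y = Y * x + 2%:R * k * y * Y.
Hypothesis ep : 2%:R * p =
  (X * x + x * X) * A + 2%:R * (X * y + x * Y) * B + 2%:R * y * Y * C.

Let coordX := - (X * B) - Y * C + X * t - 4%:R * k * Y * B - 3%:R * k * X * A.
Let coordY := X * A + Y * B + Y * t - k * Y * A.

Lemma linear_formE :
  x * coordY - y * coordX - 2%:R * k * y * coordY =
  p + (x * Y - y * X - 2%:R * k * y * Y) * t.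
Proof.
apply: two_reg; rewrite [RHS]mulrDr ep /coordX /coordY.
ncring [:: k; t; y; Y; x; X; A; B; C]
  (Xy, Xx, xY, ck x, ck y, ck X, ck Y, ct x, ct y, ct X, ct Y).
Qed.

Hypothesis AX : A * X = X * A - 4%:R * k * Y * A.
Hypothesis AY : A * Y = Y * A.
Hypothesis BX : B * X = X * B + 2%:R * k * X * A + 4%:R * k ^+ 2 * Y * A.
Hypothesis BY : B * Y = Y * B - 2%:R * k * Y * A.
Hypothesis BA : B * A = A * B - 4%:R * k * A ^+ 2.
Hypothesis t2 : 2%:R * t ^+ 2 = - (2%:R * (A * C) - 2%:R * B ^+ 2
  - 4%:R * k * A * B + 6%:R * k ^+ 2 * A ^+ 2).

Lemma projective_coordinateE :
  A * (coordX + k * coordY) = (- B + t - 4%:R * k * A) * coordY.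
Proof.
(* The added term cancels t^2 on the right and, rewritten by [t2], supplies the discriminant on the
   left. *)
apply: two_reg; apply: (addrI (- (Y * (2%:R * t ^+ 2)))); rewrite [in LHS]t2.
rewrite /coordX /coordY.
ncring [:: k; t; Y; X; A; B; C]
  (AX, AY, BX, BY, BA, ck X, ck Y, ck A, ck B, ck C, ct k, ct X, ct Y, ct A, ct B, ct C).
Qed.

End Factorization.

Section Units.
Variables (Q K : unitRingType) (j : {rmorphism Q -> K}).
Hypothesis divQ : forall q : Q, q != 0 -> q \is a GRing.unit.

(** The norm (q + t)(q - t) = q^2 - c lies in Q. The left inverses force it to be nonzero, hence
    invertible, which provides a right inverse. *)
Lemma unitr_of_left_inverses (q c : Q) (t l l' : K) :
  (forall a, a * t = t * a) -> t ^+ 2 = j c ->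
  l * (j q + t) = 1 -> l' * (j q - t) = 1 -> j q + t \is a GRing.unit.
Proof.
move=> ct tc lq lq'.
have norm : (j q + t) * (j q - t) = j (q ^+ 2 - c).
  rewrite rmorphB rmorphXn -tc.
  by rewrite mulrDl !mulrBr -ct addrA subrK !expr2.
have norm_unit : q ^+ 2 - c \is a GRing.unit.
  apply: divQ; apply: contra_eq_neq lq' => qc0.
  have : l' * (l * ((j q + t) * (j q - t))) = 0.
    by rewrite norm qc0 rmorph0 !mulr0.
  by rewrite (mulrA l) lq mul1r => ->; rewrite eq_sym oner_eq0.
have right_inv : (j q + t) * ((j q - t) * j (q ^+ 2 - c)^-1) = 1.
  by rewrite mulrA norm -rmorphM mulrV // rmorph1.
apply/unitrP; exists l; split=> //.
suff -> : l = (j q - t) * j (q ^+ 2 - c)^-1 by [].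
by rewrite -[LHS]mulr1 -right_inv mulrA lq mul1r.
Qed.

End Units.

Section HalfScalar.
Variables (R : realType) (h : R[i]) (A : algType R[i]).

(** All scalars become integer multiples of powers of the central element h/2, the form that
    [ncring] handles. *)
Lemma half_scalarE (a : A) :
  [/\ h *: a = 2%:R * (h / 2)%:A * a, (2 * h) *: a = 4%:R * (h / 2)%:A * a,
      (3 / 2 * h) *: a = 3%:R * (h / 2)%:A * a &
      (3 * h ^+ 2 / 2) *: a = 6%:R * (h / 2)%:A ^+ 2 * a].
Proof.
have nk n c : n%:R * c%:A * a = (c *+ n) *: a.
  by rewrite mulr_natl scalerMnl mulr_algl.
split; [rewrite nk..|rewrite -in_algE -rmorphXn /= nk]; congr (_ *: _); by field.
Qed.

Lemma half_scalar_central (a : A) : a * (h / 2)%:A = (h / 2)%:A * a.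
Proof. by rewrite mulr_algl mulr_algr. Qed.

Lemma two_scaleE (a : A) : 2 *: a = 2%:R * a.
Proof. by rewrite scaler_nat mulr_natl. Qed.

Lemma two_regular (a b : A) : 2%:R * a = 2%:R * b -> a = b.
Proof.
rewrite -!two_scaleE; apply: scalerI; first by rewrite pnatr_eq0.
Qed.

End HalfScalar.

(** * Polarizations and coefficients of a quadratic form in H_I *)

Section QuadraticForms.
Variables (R : realType) (h : R[i]) (d : Order.disp_t) (I : orderType d).
Variables (i0 i1 : I) (HI : algType R[i]) (gx gy : I -> HI).
Variables (E F H : {linear HI -> HI}).
Hypothesis neq01 : i0 != i1.
Hypothesis HI_pres : presents_HI h gx gy.
Hypothesis HI_act : HI_action h gx gy E F H.
Hypothesis domHI : forall a b : HI, a * b = 0 -> a = 0 \/ b = 0.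
Variable Delta : {linear HI -> HI}.
Hypothesis DeltaP : is_polar_derivation gx gy i0 i1 Delta.
Variable P01 : HI -> HI.
Hypothesis P01P : is_polarization gx gy i0 Delta P01.
Variables f A B C : HI.
Let J := [pred i | (i != i0) && (i != i1)].
Hypothesis A_in : HJ gx gy J A.
Hypothesis B_in : HJ gx gy J B.
Hypothesis C_in : HJ gx gy J C.
Hypothesis f_eq :
  f = gx i0 ^+ 2 * A + 2 *: (gx i0 * gy i0 * B) + gy i0 ^+ 2 * C.
Hypothesis f_neq0 : f != 0.
Hypothesis f_inv : invariants E F H f.

Let k : HI := (h / 2)%:A.
Let x := gx i0. Let y := gy i0. Let X := gx i1. Let Y := gy i1.
Let p := P01 f.
Let g := P01 (P01 f).
Let z := x * Y - y * X - 2%:R * k * y * Y.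

Lemma form_relations : [/\ x * y = y * x + 2%:R * k * y * y,
  x * Y = Y * x + 2%:R * k * y * Y, X * y = y * X + 2%:R * k * y * Y,
  X * Y = Y * X + 2%:R * k * Y * Y &
  Y * y = y * Y /\ X * x = x * X - 2%:R * k * Y * x + 2%:R * k * y * X].
Proof.
have [/HI_relationsE[rxy ryy rxx] _] := HI_pres.
have hE a : h *: a = 2%:R * k * a by have [] := half_scalarE h a.
rewrite -!(mulrA (2%:R * k)) -!hE; split; try exact: rxy.
  by rewrite rxy ryy.
by split; [apply: ryy | apply: rxx].
Qed.

Lemma bracketE : bracket h gx gy i0 i1 = z.
Proof.
by rewrite /bracket /z -!(mulrA (2%:R * k)); have [-> _ _ _] := half_scalarE h (y * Y).
Qed.

Lemma quadratic_eq : f = x ^+ 2 * A + 2%:R * (x * y * B) + y ^+ 2 * C.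
Proof. by rewrite f_eq two_scaleE. Qed.

Let i0J : i0 \notin J. Proof. by rewrite !inE eqxx. Qed.
Let i1i0 : (i1 == i0) = false. Proof. by rewrite eq_sym; apply: negbTE. Qed.

Let hA := HJ_homogeneous0 i0J A_in.
Let hB := HJ_homogeneous0 i0J B_in.
Let hC := HJ_homogeneous0 i0J C_in.
Let hx : homogeneous gx gy i0 1 x.
Proof. by have := homog_x gx gy i0 i0; rewrite eqxx. Qed.
Let hy : homogeneous gx gy i0 1 y.
Proof. by have := homog_y gx gy i0 i0; rewrite eqxx. Qed.
Let hX : homogeneous gx gy i0 0 X.
Proof. by have := homog_x gx gy i0 i1; rewrite i1i0. Qed.
Let hY : homogeneous gx gy i0 0 Y.
Proof. by have := homog_y gx gy i0 i1; rewrite i1i0. Qed.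
Let h2 : homogeneous gx gy i0 0 2%:R.
Proof. by have := homog_scalar gx gy i0 2%:R; rewrite scaler_nat. Qed.

(** [P01] is specified on homogeneous elements only, so f is exhibited as homogeneous of degree
    2. *)
Lemma polar1E : p = 2^-1 *: Delta f.
Proof.
apply: P01P => //; rewrite quadratic_eq.
exact: (homog_add (homog_add (homog_mul (homog_mul hx hx) hA)
  (homog_mul h2 (homog_mul (homog_mul hx hy) hB)))
  (homog_mul (homog_mul hy hy) hC)).
Qed.

Lemma linear_natl (T : {linear HI -> HI}) n a : T (n%:R * a) = n%:R * T a.
Proof. by rewrite !mulr_natl linearMn. Qed.

Lemma Delta_form : Delta f =
  (X * x + x * X) * A + 2%:R * (X * y + x * Y) * B + 2%:R * y * Y * C.
Proof.
have [_ _ _ _ [Yy _]] := form_relations.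
have [DM [Dx Dy] _] := DeltaP.
have [DA DB DC] : [/\ Delta A = 0, Delta B = 0 & Delta C = 0].
  by split; apply: (Delta_HJ DeltaP i0J).
rewrite quadratic_eq !linearD linear_natl /= !DM DA DB DC Dx Dy !mulr0 !addr0.
rewrite -/x -/y -/X -/Y.
ncring [:: x; y; X; Y; A; B; C] (Yy).
Qed.

Lemma polar1_eq : 2%:R * p =
  (X * x + x * X) * A + 2%:R * (X * y + x * Y) * B + 2%:R * y * Y * C.
Proof.
by rewrite -two_scaleE polar1E scalerA divff ?pnatr_eq0 // scale1r Delta_form.
Qed.

Lemma polar2E : g = Delta p.
Proof.
rewrite /g; have -> : Delta p = 1%:R^-1 *: Delta p by rewrite invr1 scale1r.
apply: P01P => //; rewrite -/p polar1E Delta_form -mulr_algl.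
have h22 := homog_scalar gx gy i0 2^-1.
exact: (homog_mul h22 (homog_add (homog_add
  (homog_mul (homog_add (homog_mul hX hx) (homog_mul hx hX)) hA)
  (homog_mul (homog_mul h2 (homog_add (homog_mul hX hy) (homog_mul hx hY))) hB))
  (homog_mul (homog_mul (homog_mul h2 hy) hY) hC))).
Qed.

Lemma polar2_eq : g = X ^+ 2 * A + 2%:R * (X * Y * B) + Y ^+ 2 * C.
Proof.
have [DM [Dx Dy] D0] := DeltaP.
have [DA DB DC] : [/\ Delta A = 0, Delta B = 0 & Delta C = 0].
  by split; apply: (Delta_HJ DeltaP i0J).
have [DX DY] : Delta X = 0 /\ Delta Y = 0 by apply: D0; rewrite i1i0.
apply: (@two_regular R); rewrite polar2E -[RHS]addr0 -(linear0 Delta).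
rewrite -linear_natl polar1_eq -!mulrA !linearD !linear_natl /= !DM.
rewrite DA DB DC !linearD /= !DM DX DY Dx Dy -/x -/y -/X -/Y linear0.
(* The equality holds in the free algebra; a trivial identity fills the rule list. *)
ncring [:: x; y; X; Y; A; B; C] (erefl (x * y)).
Qed.

Lemma polar1_inv : invariants E F H p.
Proof.
rewrite polar1E -[_ *: _]addr0; apply: invariants_lin.
  exact: (Delta_invariant HI_pres HI_act DeltaP).
by split; rewrite linear0.
Qed.

Lemma polar2_inv : invariants E F H g.
Proof.
by rewrite polar2E; apply: (Delta_invariant HI_pres HI_act DeltaP polar1_inv).
Qed.

Lemma central_of_inv a : invariants E F H a -> forall b, b * a = a * b.
Proof.
by move=> [_ Fa Ha] b; apply: (invariant_central HI_pres HI_act).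
Qed.

Lemma z_inv : invariants E F H z.
Proof. by rewrite -bracketE; apply: (bracket_invariant HI_act). Qed.

Lemma z_neq0 : z != 0.
Proof. by rewrite -bracketE; case: (bracket_neq0 HI_pres neq01). Qed.

Lemma Y_neq0 : Y != 0.
Proof. by case: (bracket_neq0 HI_pres neq01). Qed.

(* Exchanging the indices 0 and 1 exchanges f and P01 (P01 f).                *)
Lemma polar2_neq0 : g != 0.
Proof.
have [phi [phix phiy phig]] := HI_swap HI_pres neq01.
have phiJ a : HJ gx gy J a -> phi a = a.
  apply: (HJ_ind (P := fun a => phi a = a)) => [|c u v pu pv|u v pu pv|i].
  - exact: rmorph1.
  - by rewrite linearP /= pu pv.
  - by rewrite rmorphM /= pu pv.
  by rewrite inE => /andP[ii0 ii1]; apply: phig.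
apply: contraNneq f_neq0 => g0; have := congr1 phi g0.
rewrite rmorph0 polar2_eq !expr2 !linearD (linear_natl phi) /= !rmorphM /=.
by rewrite phix phiy !phiJ // -!expr2 -quadratic_eq => ->.
Qed.

Let two_neq0 : 2%:R != 0 :> HI.
Proof.
apply/eqP => two0; have /eqP := oner_neq0 HI; apply.
by apply: (@two_regular R); rewrite two0 !mul0r.
Qed.

Let ck := half_scalar_central h (A := HI).
Let cf := central_of_inv f_inv.
Let cp := central_of_inv polar1_inv.
Let cg := central_of_inv polar2_inv.
Let cz := central_of_inv z_inv.

Lemma coef_commute : [/\ A * X = X * A - 4%:R * k * Y * A, A * Y = Y * A,
  B * X = X * B + 2%:R * k * X * A + 4%:R * k ^+ 2 * Y * A,
  B * Y = Y * B - 2%:R * k * Y * A & B * A = A * B - 4%:R * k * A ^+ 2].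
Proof.
have [xy xY Xy XY [Yy Xx]] := form_relations.
have [ef ep eg] := And3 quadratic_eq polar1_eq polar2_eq.
split.
- exact: (commAX domHI z_neq0 ck cf cp cg cz xy xY Xy XY Yy Xx ef ep eg).
- exact: (commAY domHI z_neq0 ck cf cp cg cz xy xY Xy XY Yy Xx ef ep eg).
- exact: (commBX domHI two_neq0 z_neq0 ck cf cp cg cz xy xY Xy XY Yy Xx ef ep eg).
- exact: (commBY domHI two_neq0 z_neq0 ck cf cp cg cz xy xY Xy XY Yy Xx ef ep eg).
exact: (commBA domHI two_neq0 z_neq0 ck cf cp cg cz xy xY Xy XY Yy Xx ef ep eg).
Qed.

Lemma form_discriminantE :
  2%:R * (f * g) = 2%:R * p ^+ 2
    + (2%:R * (A * C) - 2%:R * B ^+ 2 - 4%:R * k * A * B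
       + 6%:R * k ^+ 2 * A ^+ 2) * z ^+ 2.
Proof.
have [xy xY Xy XY [Yy Xx]] := form_relations.
have [ef ep eg] := And3 quadratic_eq polar1_eq polar2_eq.
exact: (discriminantE domHI two_neq0 z_neq0 ck cf cp cg cz xy xY Xy XY Yy Xx ef ep eg).
Qed.

Lemma E_mull_inv a b : invariants E F H a -> E (a * b) = a * E b.
Proof.
move=> a_inv; rewrite -(central_of_inv a_inv) (E_mulr_inv HI_act _ a_inv).
by rewrite (central_of_inv a_inv).
Qed.

(* If A = 0, then applying E to the expression of z^2 A in the invariants     *)
(* gives B = 0, and applying E to that of z^2 B gives C = 0.                  *)
Lemma lead_coef_neq0 : A != 0.
Proof.
have [xy xY Xy XY [Yy Xx]] := form_relations.
have [ef ep eg] := And3 quadratic_eq polar1_eq polar2_eq.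
have hE a : h *: a = 2%:R * k * a by have [] := half_scalarE h a.
have [_ [Ex Ey] _] := HI_act.2 i0; have [_ [EX EY] _] := HI_act.2 i1.
have EM a b : E (a * b) = E a * expop F (- h) b + expop F h a * E b.
  exact: (Uh_ME HI_act.1).
apply: contra_neq f_neq0 => A0.
have zA := coefA ck cf cp cg xy xY Xy XY Yy Xx ef ep eg.
have zB := coefB domHI two_neq0 ck cf cp cg xy xY Xy XY Yy Xx ef ep eg.
have B0 : B = 0.
  apply: (coefB_eq0 domHI two_neq0 z_neq0 ck cf cp cg xy xY Xy XY Yy Xx ef ep eg) => //.
  have := congr1 E zA; rewrite A0 mulr0 linear0.
  rewrite -!mulrA linearD linearB linear_natl /=.
  rewrite (E_mull_inv _ f_inv) (E_mull_inv _ polar1_inv) (E_mull_inv _ polar2_inv).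
  rewrite !expr2 !EM !(expF_y HI_act) Ey EY => EzA.
  exact: esym EzA.
have C0 : C = 0.
  apply: (coefC_eq0 domHI two_neq0 z_neq0 ck cf cp cg xy xY Xy XY Yy Xx ef ep eg) => //.
  have := congr1 E zB; rewrite A0 B0 mulr0 addr0 mulr0 linear0.
  rewrite !linearB /=.
  rewrite (E_mull_inv _ f_inv) (E_mull_inv _ polar1_inv) (E_mull_inv _ polar2_inv).
  rewrite linearD /= !EM !(expF_y HI_act) !(expF_x HI_act) Ex EX Ey EY.
  rewrite !hE !mul0r !add0r => EzB.
  exact: esym EzB.
by rewrite ef A0 B0 C0 !mulr0 !addr0.
Qed.

End QuadraticForms.

(** * Decomposition over the quotient ring and its quadratic extension *)

Lemma right_quotient_domain (R : realType) (HI : algType R[i])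
    (Q : unitAlgType R[i]) (iota : {lrmorphism HI -> Q}) :
  is_right_quotient_ring iota -> forall a b : HI, a * b = 0 -> a = 0 \/ b = 0.
Proof.
move=> [divQ iota_inj _] a b ab0; have [->|a_neq0] := eqVneq a 0; first by left.
right; apply: (iota_inj); rewrite rmorph0.
have ia_unit : iota a \is a GRing.unit.
  by apply: divQ; apply: contra_neq a_neq0 => ia0; apply: (iota_inj); rewrite rmorph0.
by apply: (mulrI ia_unit); rewrite mulr0 -rmorphM ab0 rmorph0.
Qed.

Theorem mainTheorem5 (R : realType) (h : R[i]) (h_neq0 : h != 0)
    (d : Order.disp_t) (I : orderType d) (i0 i1 : I) (neq01 : i0 != i1)
    (HI : algType R[i]) (gx gy : I -> HI) (HI_pres : presents_HI h gx gy)
    (E F H : {linear HI -> HI}) (HI_act : HI_action h gx gy E F H)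
    (Q : unitAlgType R[i]) (iota : {lrmorphism HI -> Q})
    (Q_quot : is_right_quotient_ring iota)
    (Delta01 : {linear HI -> HI})
    (Delta01P : is_polar_derivation gx gy i0 i1 Delta01)
    (P01 : HI -> HI) (P01P : is_polarization gx gy i0 Delta01 P01)
    (f A B C : HI)
    (A_in : HJ gx gy [pred i | (i != i0) && (i != i1)] A)
    (B_in : HJ gx gy [pred i | (i != i0) && (i != i1)] B)
    (C_in : HJ gx gy [pred i | (i != i0) && (i != i1)] C)
    (f_eq : f = gx i0 ^+ 2 * A + 2 *: (gx i0 * gy i0 * B) + gy i0 ^+ 2 * C)
    (f_form : is_form (gx i0) (gy i0) (HJ gx gy [pred i | i != i0])
                (invariants E F H) 2 f) :
  let d2 := 2 *: (A * C) - 2 *: B ^+ 2 - (2 * h) *: (A * B)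
            + (3 * h ^+ 2 / 2) *: A ^+ 2 in
  let b01 := bracket h gx gy i0 i1 in
  f * P01 (P01 f) = P01 f ^+ 2 + 2^-1 *: (d2 * b01 ^+ 2)
  /\
  forall (K : unitAlgType R[i]) (j : {lrmorphism Q -> K}) (s : K),
    is_sqrt_extension j (iota (- 2^-1 *: d2)) s ->
    let phi := fun a : HI => j (iota a) in
    let x := phi (gx i0) in let y := phi (gy i0) in
    let x1 := phi (gx i1) in let y1 := phi (gy i1) in
    let X := fun t : K =>
      - (x1 * phi B) - y1 * phi C + x1 * t - (2 * h) *: (y1 * phi B)
      - (3 / 2 * h) *: (x1 * phi A) in
    let Y := fun t : K =>
      x1 * phi A + y1 * phi B + y1 * t - (h / 2) *: (y1 * phi A) in
    let X1 := X s in let Y1 := Y s in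
    let X2 := X (- s) in let Y2 := Y (- s) in
    let L1 := phi (P01 f) + phi b01 * s in
    let L2 := phi (P01 f) - phi b01 * s in
    let M1 := x * Y1 - y * X1 - h *: (y * Y1) in
    let M2 := x * Y2 - y * X2 - h *: (y * Y2) in
    let linear_form := is_form x y
      (adjoin phi s (HJ gx gy [pred i | i != i0]))
      (adjoin phi s (invariants E F H)) 1 in
    [/\ phi (f * P01 (P01 f)) = L1 * L2 /\ L1 * L2 = M1 * M2,
        [/\ linear_form L1, linear_form L2, linear_form M1 & linear_form M2],
        [/\ Y1 \is a GRing.unit, Y2 \is a GRing.unit
          & phi A \is a GRing.unit],
        X1 / Y1 + (h / 2)%:A = (- phi B + s) / phi A
      & X2 / Y2 + (h / 2)%:A = (- phi B - s) / phi A].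
Proof.
move=> d2 b01.
have domHI := right_quotient_domain Q_quot.
have [divQ iota_inj _] := Q_quot.
have [f_neq0 f_inv _] := f_form.
pose k : HI := (h / 2)%:A; pose p := P01 f; pose g := P01 (P01 f).
have p_inv : invariants E F H p.
  exact: (polar1_inv HI_pres HI_act Delta01P P01P A_in B_in C_in f_eq f_inv).
have b01_inv : invariants E F H b01 by apply: (bracket_invariant HI_act).
have cp := central_of_inv HI_pres HI_act p_inv.
have cb01 := central_of_inv HI_pres HI_act b01_inv.
have g_neq0 : g != 0.
  exact: (polar2_neq0 neq01 HI_pres Delta01P P01P A_in B_in C_in f_eq f_neq0).
have A_neq0 : A != 0.
  exact: (lead_coef_neq0 neq01 HI_pres HI_act domHI Delta01P P01P A_in B_in
            C_in f_eq f_neq0 f_inv).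
have ep := polar1_eq HI_pres Delta01P P01P A_in B_in C_in f_eq.
have b01E := bracketE h i0 i1 gx gy; rewrite -/b01 in b01E.
have fgE := form_discriminantE neq01 HI_pres HI_act domHI Delta01P P01P
              A_in B_in C_in f_eq f_inv.
have d2E : d2 = 2%:R * (A * C) - 2%:R * B ^+ 2 - 4%:R * k * A * B
                + 6%:R * k ^+ 2 * A ^+ 2.
  rewrite /d2 !two_scaleE -(mulrA (4%:R * k)).
  have [_ -> _ _] := half_scalarE h (A * B).
  by have [_ _ _ ->] := half_scalarE h (A ^+ 2).
rewrite -b01E -/k -d2E in fgE.
split.
  apply: (@two_regular R); rewrite fgE mulrDr; congr (_ + _).
  by rewrite -[RHS]two_scaleE scalerA divff ?scale1r // pnatr_eq0.
clearbody d2 b01.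
move=> K j s [cs s2 _] phi x y x1 y1 X Y X1 Y1 X2 Y2 L1 L2 M1 M2 linear_form.
pose ph : {rmorphism HI -> K} := j \o iota.
have phZ c a : ph (c *: a) = c *: ph a by rewrite /= !linearZ.
pose kK : K := (h / 2)%:A.
have phk : ph (h / 2)%:A = kK by rewrite phZ rmorph1.
pose phE := (@rmorph_nat _ _ ph, @rmorphXn _ _ ph, @rmorphB _ _ ph,
             @rmorphN _ _ ph, @rmorphD _ _ ph, @rmorphM _ _ ph, phk).
have ph_unit a : a != 0 -> ph a \is a GRing.unit.
  move=> a_neq0; apply/rmorph_unit/divQ; apply: contra_neq a_neq0 => ia0.
  by apply: (iota_inj); rewrite rmorph0.
have ckK (a : K) : a * kK = kK * a by apply: half_scalar_central.
have [_ xY Xy _ [_ Xx]] := form_relations i0 i1 HI_pres.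
have [AX AY BX BY BA] := coef_commute neq01 HI_pres HI_act domHI Delta01P P01P
                           A_in B_in C_in f_eq f_inv.
have XE t : X t = - (x1 * phi B) - y1 * phi C + x1 * t
    - 4%:R * kK * y1 * phi B - 3%:R * kK * x1 * phi A.
  rewrite /X -(mulrA (4%:R * kK)) -(mulrA (3%:R * kK)).
  have [_ -> _ _] := half_scalarE h (y1 * phi B).
  by have [_ _ -> _] := half_scalarE h (x1 * phi A).
have YE t : Y t = x1 * phi A + y1 * phi B + y1 * t - kK * y1 * phi A.
  by rewrite /Y -(mulrA kK) /kK mulr_algl.
(* From here on t stands for s or - s, which treats both signs at once. *)
have phM (t : K) : (forall a, a * t = t * a) ->
    x * Y t - y * X t - 2%:R * kK * (y * Y t) = ph p + ph b01 * t.
  move=> ct; rewrite (mulrA (2%:R * kK)) XE YE b01E.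
  have {}Xy := congr1 ph Xy; have {}Xx := congr1 ph Xx.
  have {}xY := congr1 ph xY; have {}ep := congr1 ph ep.
  rewrite !phE in Xy Xx xY ep *.
  exact: (linear_formE (@two_regular R K) ckK ct Xy Xx xY ep).
have coordE (t : K) : (forall a, a * t = t * a) -> t ^+ 2 = s ^+ 2 ->
    phi A * (X t + kK * Y t) = (- phi B + t - 4%:R * kK * phi A) * Y t.
  move=> ct ts; rewrite XE YE.
  have t2 : 2%:R * t ^+ 2 = - ph d2.
    rewrite ts s2 -two_scaleE -[j (iota _)]/(ph _) -phZ scalerA mulrN.
    by rewrite divff ?pnatr_eq0 // scaleN1r rmorphN.
  have {}AX := congr1 ph AX; have {}AY := congr1 ph AY.
  have {}BX := congr1 ph BX; have {}BY := congr1 ph BY.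
  have {}BA := congr1 ph BA; rewrite d2E /k in t2.
  rewrite !phE in AX AY BX BY BA t2.
  exact: (projective_coordinateE (@two_regular R K) ckK ct AX AY BX BY BA t2).
have cNs a : a * - s = - s * a by rewrite mulrN mulNr cs.
have cs' a : a * s = s * a by [].
have MsE : M1 = L1.
  rewrite /M1; have [-> _ _ _] := half_scalarE h (y * Y1).
  exact: (phM s cs').
have MNsE : M2 = L2.
  rewrite /M2; have [-> _ _ _] := half_scalarE h (y * Y2).
  by rewrite /L2 -[in RHS]mulrN; exact: (phM (- s) cNs).
have LLE : L1 * L2 = phi (f * g).
  have pz : ph p * ph b01 = ph b01 * ph p by rewrite -!rmorphM cb01.
  have ss : 2%:R * s ^+ 2 = - ph d2.
    rewrite s2 -two_scaleE -[j (iota _)]/(ph _) -phZ scalerA mulrN.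
    by rewrite divff ?pnatr_eq0 // scaleN1r rmorphN.
  apply: (@two_regular R); transitivity (2%:R * ph p ^+ 2 - ph b01 ^+ 2 * (2%:R * s ^+ 2)).
    rewrite /L1 /L2 -/p -[phi p]/(ph p) -[phi b01]/(ph b01).
    ncring [:: s; ph b01; ph p] (cs' (ph b01), cs' (ph p), pz).
  rewrite ss -[phi _]/(ph _) -[2%:R in RHS](rmorph_nat ph) -rmorphM fgE.
  rewrite !phE mulrN opprK; congr (_ + _).
  rewrite -rmorphXn -!rmorphM; congr (ph _).
  have cb2 a : a * b01 ^+ 2 = b01 ^+ 2 * a.
    by rewrite expr2 mulrA cb01 -mulrA cb01 mulrA.
  by rewrite cb2.
have LL_unit : L1 * L2 \is a GRing.unit.
  rewrite LLE; apply: ph_unit; apply/eqP => /domHI [/eqP|/eqP].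
    by rewrite (negPf f_neq0).
  by rewrite (negPf g_neq0).
have LLC : L2 * L1 = L1 * L2.
  have pz : ph p * ph b01 = ph b01 * ph p by rewrite -!rmorphM cb01.
  rewrite /L1 /L2 -/p -[phi p]/(ph p) -[phi b01]/(ph b01).
  ncring [:: s; ph b01; ph p] (cs' (ph b01), cs' (ph p), pz).
have A_unit : phi A \is a GRing.unit by apply: ph_unit.
have y1_unit : y1 \is a GRing.unit.
  by apply: ph_unit; apply: (Y_neq0 neq01 HI_pres).
have BAK : phi B * phi A = phi A * phi B - 4%:R * kK * phi A ^+ 2.
  by have := congr1 ph BA; rewrite !phE.
(* The projective coordinate without division by [Y t], whose invertibility is still open. Moving A
   across - B + t absorbs the term 4 k A. *)
have XNY (t : K) : (forall a, a * t = t * a) -> t ^+ 2 = s ^+ 2 ->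
    X t = ((- phi B + t) / phi A - kK) * Y t.
  move=> ct ts; rewrite mulrBl; apply/eqP; rewrite eq_sym subr_eq; apply/eqP.
  apply: (mulrI A_unit); rewrite coordE // mulrA; congr (_ * _).
  apply: (mulIr A_unit); rewrite -!mulrA mulVr // mulr1.
  ncring [:: kK; t; phi A; phi B] (ct (phi A), BAK, ckK (phi A)).
have [L1_unit L2_unit] : L1 \is a GRing.unit /\ L2 \is a GRing.unit.
  by move: LL_unit; rewrite unitrM_comm // => /andP[].
(* [Y t] is w + y_1 t, so [Y t / y1] has the shape q + t with q in Q, as the norm argument
   requires. *)
pose w : HI := gx i1 * A + gy i1 * B - (h / 2) *: (gy i1 * A).
pose q : Q := iota w / iota (gy i1).
have qE : j q = ph w / y1.
  rewrite /q rmorphM rmorphV //; apply: divQ.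
  apply: contraTneq y1_unit => iy0.
  by rewrite /y1 /phi iy0 rmorph0 unitr0.
have YwE t : Y t = phi w + y1 * t.
  rewrite /w -[phi _]/(ph _) rmorphB rmorphD phZ !rmorphM /=.
  by rewrite /Y addrAC.
have qtE (t : K) : (forall a, a * t = t * a) -> j q + t = Y t / y1.
  by move=> ct; rewrite YwE mulrDl qE (ct y1) mulrK.
have left_inv (t : K) : (forall a, a * t = t * a) -> t ^+ 2 = s ^+ 2 ->
    ph p + ph b01 * t \is a GRing.unit -> exists l, l * (j q + t) = 1.
  move=> ct ts M_unit; pose N := (- phi B + t) / phi A - kK.
  have XN : X t = N * Y t by apply: XNY.
  clearbody N.
  (* Inserting X = N Y shows the linear form as a left multiple of Y; its invertibility then yields
     a left inverse of Y. *)
  have [G GE] : exists G, G * Y t = ph p + ph b01 * t.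
    exists (x - y * N - 2%:R * kK * y).
    by rewrite -phM // XN !mulrBl !mulrA.
  exists (y1 * ((ph p + ph b01 * t)^-1 * G)).
  by rewrite qtE // -!mulrA (mulrA G) GE (mulrA _ _ y1^-1) mulVr // mul1r mulrV.
have sN2 : (- s) ^+ 2 = s ^+ 2 by rewrite sqrrN.
have [l lq] := left_inv s cs' erefl L1_unit.
have L2_unit' : ph p + ph b01 * - s \is a GRing.unit by rewrite mulrN.
have [l' lq'] := left_inv (- s) cNs sN2 L2_unit'.
have Y_unit (t : K) : (forall a, a * t = t * a) ->
    j q + t \is a GRing.unit -> Y t \is a GRing.unit.
  by move=> ct; rewrite qtE // unitrMl // unitrV.
have Y1_unit : Y1 \is a GRing.unit.
  by apply: Y_unit => //; apply: (unitr_of_left_inverses divQ cs' s2 lq lq').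
have Y2_unit : Y2 \is a GRing.unit.
  apply: Y_unit => //; apply: (unitr_of_left_inverses divQ cNs (etrans sN2 s2) lq').
  by rewrite opprK; exact: lq.
have adjoinE (S : set HI) t a b : (forall c, S c -> S (- c)) ->
    t = s \/ t = - s -> S a -> S b -> adjoin phi s S (phi a + phi b * t).
  move=> SN [->|->] Sa Sb; first by exists a, b.
  exists a, (- b); split=> //; first exact: SN.
  by rewrite -[phi (- b)]/(ph _) rmorphN mulNr mulrN.
have invN c : invariants E F H c -> invariants E F H (- c).
  by move=> [Ec Fc Hc]; split; rewrite linearN ?Ec ?Fc ?Hc oppr0.
pose J0 := [pred i | i != i0].
have HJN c : HJ gx gy J0 c -> HJ gx gy J0 (- c).
  by rewrite -scaleN1r; apply: HJZ.
have JJ0 : {subset [pred i | (i != i0) && (i != i1)] <= J0}.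
  by move=> i; rewrite !inE => /andP[].
have [A0 B0 C0] : [/\ HJ gx gy J0 A, HJ gx gy J0 B & HJ gx gy J0 C].
  by split; apply: HJ_sub JJ0 _.
have [x1J y1J] : HJ gx gy J0 (gx i1) /\ HJ gx gy J0 (gy i1).
  by apply: HJ_gen; rewrite inE eq_sym.
have wJ : HJ gx gy J0 w.
  by apply: HJD; [apply: HJD; apply: HJM | apply/HJN/HJZ/HJM].
pose u : HI := - (gx i1 * B) - gy i1 * C - (2 * h) *: (gy i1 * B)
  - (3 / 2 * h) *: (gx i1 * A).
have uJ : HJ gx gy J0 u.
  have SB a : HJ gx gy J0 a -> HJ gx gy J0 (gx i1 * a) by apply: HJM.
  have SC a : HJ gx gy J0 a -> HJ gx gy J0 (gy i1 * a) by apply: HJM.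
  apply: HJD; last by apply/HJN/HJZ/SB.
  apply: HJD; last by apply/HJN/HJZ/SC.
  by apply: HJD; apply: HJN; [apply: SB | apply: SC].
have XuE t : X t = phi u + x1 * t.
  rewrite /u -[phi _]/(ph _) !rmorphB rmorphN !phZ !rmorphM /= /X.
  by rewrite [RHS]addrAC; congr (_ + _); rewrite [RHS]addrAC.
clearbody u w.
have formE t (L : K) : t = s \/ t = - s -> L \is a GRing.unit ->
    L = ph p + ph b01 * t -> L = x * Y t - y * X t - h *: (y * Y t) ->
    linear_form L.
  move=> ts L_unit LE ME; split.
  - by apply: contraTneq L_unit => ->; rewrite unitr0.
  - by rewrite LE; apply: adjoinE.
  (* The term - h y Y is collected into the coefficient of y. *)
  exists (fun i : 'I_2 => if i == ord0 then Y t else - (X t + h *: Y t)).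
    move=> i; case: ifP => _.
      by rewrite YwE; apply: adjoinE.
    have -> : - (X t + h *: Y t) =
        phi (- (u + h *: w)) + phi (- (gx i1 + h *: gy i1)) * t.
      rewrite -![phi (- _)]/(ph _) !rmorphN !rmorphD !phZ /= XuE YwE.
      by rewrite mulNr -opprD mulrDl scalerDr addrACA -scalerAl.
    apply: adjoinE => //; apply: HJN; apply: HJD => //; exact: HJZ.
  rewrite big_ord_recl big_ord1 /= expr0 expr1 !mulr1 !mul1r ME.
  by rewrite /bump expr1 mulrN (mulrDr y (X t)) opprD addrA -scalerAr.
have XYE (t : K) : (forall a, a * t = t * a) -> t ^+ 2 = s ^+ 2 ->
    Y t \is a GRing.unit -> X t / Y t + (h / 2)%:A = (- phi B + t) / phi A.
  by move=> ct ts Yt_unit; rewrite XNY // mulrK // subrK.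
split.
- by rewrite LLE MsE MNsE.
- rewrite MsE MNsE; split.
  + by apply: (formE s); rewrite ?MsE //; left.
  + by apply: (formE (- s)); rewrite -?MNsE ?MNsE ?mulrN //; right.
  + by apply: (formE s); rewrite ?MsE //; left.
  by apply: (formE (- s)); rewrite ?MNsE ?mulrN //; right.
- by split.
- exact: XYE.
exact: XYE.
Qed.
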